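(* For $n\geq 1$ and $p\geq 0$ let $Q_n^{(p)}$ be the number of rooted planar quadrangulations with a boundary of length $2p$ and $n$ vertices in total, and let $$\mathbf{Q}(x,y)=\sum_{n\geq 1}\sum_{p=0}^{n}Q_n^{(p)}x^n y^p,\qquad \mathbf{Q}^{\bullet}=x\,\partial_x\mathbf{Q},\qquad \mathfrak{Q}(x)=[y^1]\mathbf{Q}(x,y),\qquad \mathfrak{Q}^{\bullet}(x)=x\,\mathfrak{Q}'(x).$$ Then, as formal power series, $$\mathbf{Q}^{\bullet}=x+6y\,\mathbf{Q}^{\bullet}\left(\frac{\mathfrak{Q}^{\bullet}-\mathfrak{Q}}{1-\mathfrak{Q}^{\bullet}/x}\right)+2xy\left(3\mathbf{Q}^{\bullet}-2\mathbf{Q}-y\,\partial_y\mathbf{Q}\right).$$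
   Context: A planar map is a finite connected graph (loops and multiple edges allowed) properly embedded in the two-dimensional sphere, considered up to continuous (orientation-preserving) deformation. It is rooted if an oriented edge is distinguished. The degree of a face is the number of edges incident to it, i.e. the number of sides of its underlying polygon (an edge with the same face on both sides is counted twice). A rooted quadrangulation with a boundary of length $2p$ ($p\geq 1$) is a rooted planar map in which the face lying to the right of the root edge (the external face, or boundary) has degree $2p$ and all other faces have degree $4$; the boundary is not required to be simple. By convention, the map consisting of a single vertex and no edge is the unique quadrangulation with a boundary of length $0$, so $Q_1^{(0)}=1$ and $Q_n^{(0)}=0$ for $n\geq 2$. The map with two vertices and one edge is a quadrangulation with a boundary of length $2$. One has $\mathfrak{Q}(x)=x^2+2x^3+9x^4+\cdots$, so $1-\mathfrak{Q}^{\bullet}/x$ is invertible as a power series. Here $[y^1]\mathbf{Q}$ denotes the coefficient of $y^1$ in $\mathbf{Q}$, a power series in $x$. *)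

(* Defs.v *)
From HB Require Import structures.
From mathcomp Require Import all_boot all_order all_fingroup all_algebra.
From mathcomp Require Import boolp zify.

Set Implicit Arguments.
Unset Strict Implicit.
Unset Printing Implicit Defensive.

Import GRing.Theory.

(******************************************************************************)
(* Formal power series. A bivariate series in R[[x]][[y]] is an element of    *)
(* {fps {fps R}}: the outer variable is y, the inner one is x, so that the    *)
(* coefficient of y^p is a series in x.                                       *)
(******************************************************************************)

Record fps (R : Type) := FPS { fcoef : nat -> R }.

Notation "{ 'fps' R }" := (fps R) (at level 0, format "{ 'fps'  R }").

HB.instance Definition _ (R : Type) := gen_eqMixin {fps R}.
HB.instance Definition _ (R : Type) := gen_choiceMixin {fps R}.

Lemma fpsP (R : Type) (f g : {fps R}) : (forall n, fcoef f n = fcoef g n) <-> f = g.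
Proof.
split=> [|-> //]; case: f g => [f] [g] /= fg.
by congr FPS; apply: funext.
Qed.

Local Open Scope ring_scope.

Section FpsZmodule.
Variable R : zmodType.
Implicit Types f g h : {fps R}.

Definition fps_zero : {fps R} := FPS (fun=> 0).
Definition fps_opp f := FPS (fun n => - fcoef f n).
Definition fps_add f g := FPS (fun n => fcoef f n + fcoef g n).

Fact fps_addA : associative fps_add.
Proof. by move=> f g h; apply/fpsP => n; rewrite /= addrA. Qed.
Fact fps_addC : commutative fps_add.
Proof. by move=> f g; apply/fpsP => n; rewrite /= addrC. Qed.
Fact fps_add0 : left_id fps_zero fps_add.
Proof. by move=> f; apply/fpsP => n; rewrite /= add0r. Qed.
Fact fps_addN : left_inverse fps_zero fps_opp fps_add.
Proof. by move=> f; apply/fpsP => n; rewrite /= addNr. Qed.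

HB.instance Definition _ :=
  GRing.isZmodule.Build {fps R} fps_addA fps_addC fps_add0 fps_addN.

Lemma fcoef0 n : fcoef (0 : {fps R}) n = 0. Proof. by []. Qed.
Lemma fcoefN f n : fcoef (- f) n = - fcoef f n. Proof. by []. Qed.
Lemma fcoefD f g n : fcoef (f + g) n = fcoef f n + fcoef g n. Proof. by []. Qed.
Lemma fcoefB f g n : fcoef (f - g) n = fcoef f n - fcoef g n. Proof. by []. Qed.
Lemma fcoefMn f k n : fcoef (f *+ k) n = fcoef f n *+ k.
Proof. by elim: k => // k IH; rewrite !mulrS fcoefD IH. Qed.

End FpsZmodule.

Section FpsRing.
Variable R : comNzRingType.
Implicit Types f g h : {fps R}.

Definition fps_const (c : R) : {fps R} := FPS (fun n => if n == 0%N then c else 0).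
Definition fps_mul f g : {fps R} :=
  FPS (fun n => \sum_(i < n.+1) fcoef f i * fcoef g (n - i)).

Fact fcoef_mul f g n :
  fcoef (fps_mul f g) n = \sum_(i < n.+1) fcoef f i * fcoef g (n - i).
Proof. by []. Qed.

Fact fcoef_mul_rev f g n :
  fcoef (fps_mul f g) n = \sum_(i < n.+1) fcoef f (n - i) * fcoef g i.
Proof.
rewrite /= (reindex_inj rev_ord_inj) /=.
by apply: eq_bigr => j _; rewrite (sub_ordK j).
Qed.

Fact fps_mulA : associative fps_mul.
Proof.
move=> p q r; apply/fpsP => i; rewrite fcoef_mul fcoef_mul_rev.
pose coef3 j k := fcoef p j * (fcoef q (i - j - k)%N * fcoef r k).
transitivity (\sum_(j < i.+1) \sum_(k < i.+1 | (k <= i - j)%N) coef3 j k).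
  apply: eq_bigr => j _; rewrite fcoef_mul_rev big_distrr /=.
  by rewrite (big_ord_narrow_leq (leq_subr _ _)).
rewrite (exchange_big_dep predT) //; apply: eq_bigr => k _.
transitivity (\sum_(j < i.+1 | (j <= i - k)%N) coef3 j k).
  apply: eq_bigl => j; rewrite -ltnS -(ltnS j) -!subSn ?leq_ord //.
  by rewrite -subn_gt0 -(subn_gt0 j) -!subnDA addnC.
rewrite (big_ord_narrow_leq (leq_subr _ _)) fcoef_mul big_distrl /=.
by apply: eq_bigr => j _; rewrite /coef3 -!subnDA addnC mulrA.
Qed.

Fact fps_mulC : commutative fps_mul.
Proof.
move=> f g; apply/fpsP => n; rewrite fcoef_mul_rev /=.
by apply: eq_bigr => i _; rewrite mulrC.
Qed.

Fact fps_mul1 : left_id (fps_const 1) fps_mul.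
Proof.
move=> f; apply/fpsP => n; rewrite /= big_ord_recl /= subn0 mul1r.
by rewrite big1 ?addr0 // => i _; rewrite mul0r.
Qed.

Fact fps_mulDl : left_distributive fps_mul +%R.
Proof.
move=> f g h; apply/fpsP => n; rewrite fcoefD /= -big_split.
by apply: eq_bigr => i _; rewrite mulrDl.
Qed.

Fact fps1_neq0 : fps_const 1 != 0.
Proof. by apply/eqP => /fpsP/(_ 0%N)/eqP; rewrite /= oner_eq0. Qed.

HB.instance Definition _ := GRing.Zmodule_isComNzRing.Build {fps R}
  fps_mulA fps_mulC fps_mul1 fps_mulDl fps1_neq0.

Lemma fcoef1 n : fcoef (1 : {fps R}) n = (n == 0%N)%:R.
Proof. by rewrite /=; case: eqP. Qed.

Lemma fcoefM f g n :
  fcoef (f * g) n = \sum_(i < n.+1) fcoef f i * fcoef g (n - i).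
Proof. by []. Qed.

Definition fpsX : {fps R} := FPS (fun n => (n == 1%N)%:R).

Definition fps_deriv f : {fps R} := FPS (fun n => fcoef f n.+1 *+ n.+1).

(* Division by the variable of a series without constant term. *)
Definition fps_divX f : {fps R} := FPS (fun n => fcoef f n.+1).

Lemma fcoefXM f n : fcoef (fpsX * f) n = if n is m.+1 then fcoef f m else 0.
Proof.
rewrite fcoefM; case: n => [|n]; first by rewrite big_ord1 mul0r.
rewrite big_ord_recl mul0r add0r big_ord_recl mul1r subn1 /= big1 ?addr0 //.
by move=> i _; rewrite mul0r.
Qed.

Lemma fps_divXK f : fcoef f 0 = 0 -> fpsX * fps_divX f = f.
Proof. by move=> f0; apply/fpsP => -[|n]; rewrite fcoefXM. Qed.

End FpsRing.

Arguments fpsX {R}.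

(* Derivative with respect to the inner variable. *)
Definition fps_deriv_in (R : comNzRingType) (F : {fps {fps R}}) : {fps {fps R}} :=
  FPS (fun p => fps_deriv (fcoef F p)).

Section FpsUnitRing.
Variable R : comUnitRingType.
Implicit Types f g : {fps R}.

(* The first n coefficients of the inverse of f. *)
Fixpoint fps_inv_seq f n : seq R :=
  if n is m.+1 then
    let s := fps_inv_seq f m in
    rcons s (if m == 0%N then (fcoef f 0)^-1 else
             - (fcoef f 0)^-1 * \sum_(i < m) fcoef f i.+1 * s`_(m - i.+1))
  else [::].

Definition fps_unit : {pred {fps R}} := fun f => fcoef f 0 \is a GRing.unit.

Definition fps_inv f : {fps R} :=
  if fps_unit f then FPS (fun n => (fps_inv_seq f n.+1)`_n) else f.

Fact size_fps_inv_seq f n : size (fps_inv_seq f n) = n.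
Proof. by elim: n => //= n IH; rewrite size_rcons IH. Qed.

Fact nth_fps_inv_seq f n m : (m < n)%N ->
  (fps_inv_seq f n)`_m = (fps_inv_seq f m.+1)`_m.
Proof.
elim: n => // n IH; rewrite ltnS leq_eqVlt => /predU1P[-> //|lt_mn].
by rewrite [in LHS]/= nth_rcons size_fps_inv_seq lt_mn IH.
Qed.

Fact fps_mulV : {in fps_unit, left_inverse 1 fps_inv *%R}.
Proof.
move=> f Uf; rewrite mulrC; apply/fpsP => n; rewrite fcoef1 fcoefM.
rewrite /fps_inv (_ : fps_unit f = true) // big_ord_recl /= subn0.
rewrite nth_rcons size_fps_inv_seq ltnn eqxx.
case: n => [|n]; first by rewrite /= big_ord0 addr0 divrr.
rewrite /= mulrA mulrN divrr // mulN1r addrC; apply/eqP.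
rewrite subr_eq0; apply/eqP; apply: eq_bigr => i _; congr (_ * _).
rewrite -[LHS]/((fps_inv_seq f (n.+1 - bump 0 i).+1)`_(n.+1 - bump 0 i)).
rewrite -[RHS]/((fps_inv_seq f n.+1)`_(n.+1 - bump 0 i)).
by rewrite [RHS]nth_fps_inv_seq // /bump add1n subSS ltnS leq_subr.
Qed.

Fact fps_unitPl f g : g * f = 1 -> fps_unit f.
Proof.
move/fpsP/(_ 0%N); rewrite fcoefM big_ord1 subnn => gf1.
by apply/unitrPr; exists (fcoef g 0); rewrite mulrC gf1.
Qed.

Fact fps_inv_out : {in [predC fps_unit], fps_inv =1 id}.
Proof. by move=> f /negbTE Uf; rewrite /fps_inv (_ : fps_unit f = false). Qed.

HB.instance Definition _ := GRing.ComNzRing_hasMulInverse.Build {fps R}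
  fps_mulV fps_unitPl fps_inv_out.

Lemma fps_unitE f : (f \is a GRing.unit) = (fcoef f 0 \is a GRing.unit).
Proof. by []. Qed.

End FpsUnitRing.

Local Close Scope ring_scope.

(******************************************************************************)
(* Rooted maps on oriented surfaces, as rotation systems. The 2e darts are    *)
(* the oriented edges; the vertex permutation sends a dart to the next dart   *)
(* with the same origin in counterclockwise order, and the edge permutation   *)
(* reverses darts. Walking along a dart d with a face on its right, the next  *)
(* side of that face is vperm (eperm d), so the cycles of fperm are the faces *)
(* and the cycle of d is the face lying to the right of d.                    *)
(******************************************************************************)

Definition dart e := 'I_(e.*2).

Definition rmap e : Type := {perm dart e} * {perm dart e} * dart e.

Section RootedMaps.
Variable e : nat.
Implicit Types M N : rmap e.

Definition vperm M : {perm dart e} := M.1.1.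
Definition eperm M : {perm dart e} := M.1.2.
Definition root M : dart e := M.2.

(* Permutations compose from left to right: fperm M d = vperm M (eperm M d). *)
Definition fperm M : {perm dart e} := (eperm M * vperm M)%g.

Definition vertices M := porbits (vperm M).
Definition faces M := porbits (fperm M).
Definition root_face M := porbit (fperm M) (root M).

Definition edge_involution M :=
  [forall d, (eperm M d != d) && (eperm M (eperm M d) == d)].

Definition map_connected M :=
  [forall c, forall d,
     connect [rel a b | (b == vperm M a) || (b == eperm M a)] c d].

(* Euler characteristic 2; there are e edges. *)
Definition map_planar M := #|vertices M| + #|faces M| == e + 2.

Definition rooted_planar_map M :=
  [&& edge_involution M, map_connected M & map_planar M].

Definition quadrangulation (n p : nat) M :=
  [&& rooted_planar_map M, #|vertices M| == n, #|root_face M| == p.*2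
    & [forall F in faces M, (F != root_face M) ==> (#|F| == 4)]].

(* Orientation-preserving homeomorphism respecting the root. *)
Definition map_iso M N :=
  [exists f : {perm dart e},
    [&& [forall d, f (vperm M d) == vperm N (f d)],
        [forall d, f (eperm M d) == eperm N (f d)] & f (root M) == root N]].

Definition nquad_edges (n p : nat) : nat :=
  #|equivalence_partition map_iso [set M | quadrangulation n p M]|.

Lemma map_iso_equiv : equivalence_rel map_iso.
Proof.
have refl M : map_iso M M.
  by apply/existsP; exists 1%g; apply/and3P; split;
     [apply/forallP => d|apply/forallP => d|]; rewrite !perm1.
have sym M N : map_iso M N -> map_iso N M.
  case/existsP => f /and3P[/forallP fv /forallP fe /eqP fr].
  apply/existsP; exists f^-1%g; rewrite -fr permK eqxx andbT.
  by apply/andP; split; apply/forallP => d; apply/eqP/(@perm_inj _ f);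
     rewrite permKV ?(eqP (fv _)) ?(eqP (fe _)) permKV.
have trans M N P : map_iso M N -> map_iso N P -> map_iso M P.
  case/existsP => f /and3P[/forallP fv /forallP fe /eqP fr].
  case/existsP => g /and3P[/forallP gv /forallP ge /eqP gr].
  apply/existsP; exists (f * g)%g; rewrite permM fr gr eqxx andbT.
  apply/andP; split; apply/forallP => d; rewrite !permM.
    by rewrite (eqP (fv _)) (eqP (gv _)).
  by rewrite (eqP (fe _)) (eqP (ge _)).
move=> M N P; split=> [|MN]; first exact: refl.
by apply/idP/idP; apply: trans => //; apply: sym.
Qed.

Lemma quadrangulation_edges (n p : nat) M :
  quadrangulation n p M -> e + p + 2 = n.*2.
Proof.
case/and4P => /and3P[_ _ /eqP euler] /eqP Vn /eqP rp /forall_inP quad.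
have rootF : root_face M \in faces M by apply: imset_f.
have partF : partition (faces M) [set: dart e].
  have porbitE x : [set y in [set: dart e] | porbit (fperm M) x == porbit (fperm M) y] =
      porbit (fperm M) x.
    by apply/setP => y; rewrite !inE eq_sym eq_porbit_mem.
  suff -> : faces M = preim_partition (porbit (fperm M)) [set: dart e].
    exact: preim_partitionP.
  apply/setP => F; apply/imsetP/imsetP => -[x _ ->]; exists x;
    by rewrite ?inE ?porbitE.
have := card_partition partF; rewrite cardsT card_ord (bigD1 (root_face M)) //= rp.
under eq_bigr => F /andP[FF neF] do rewrite (eqP (implyP (quad F FF) neF)).
rewrite sum_nat_cond_const => eF.
have cF : #|faces M| = #|[set F in faces M | F != root_face M]|.+1.
  rewrite (cardsD1 (root_face M)) rootF add1n; congr _.+1.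
  by apply: eq_card => F; rewrite !inE andbC.
rewrite cF in euler.
by move: eF euler; move: #|_| => k; rewrite Vn; lia.
Qed.

End RootedMaps.

(* The number of edges is determined by n and p and is less than 2n (see      *)
(* quadrangulation_edges), so the sum runs over all possible edge numbers.    *)
(* The single-vertex map has no dart and is not an rmap; it accounts for the  *)
(* case p = 0.                                                                *)
Definition nquad (n p : nat) : nat :=
  if p is 0 then nat_of_bool (n == 1) else \sum_(e < n.*2) nquad_edges e n p.

Local Open Scope ring_scope.

Definition xQ : {fps rat} := fpsX.
Definition x2 : {fps {fps rat}} := fps_const xQ.
Definition y2 : {fps {fps rat}} := fpsX.

Definition Q2 : {fps {fps rat}} :=
  FPS (fun p => FPS (fun n =>
    if (1 <= n)%N && (p <= n)%N then (nquad n p)%:R else 0)).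
Definition Q2dot : {fps {fps rat}} := x2 * fps_deriv_in Q2.

Definition Q1 : {fps rat} := fcoef Q2 1.
Definition Q1dot : {fps rat} := xQ * fps_deriv Q1.

Lemma nquad11 : nquad 1 1 = 0%N.
Proof.
apply: big1 => e _; apply/eqP; rewrite cards_eq0.
rewrite (_ : [set M | _] = set0) ?/equivalence_partition ?imset0 //.
apply/setP => M; rewrite !inE; apply/negP => /quadrangulation_edges.
by rewrite -addnA addnC.
Qed.

Lemma Q1dot0 : fcoef Q1dot 0 = 0.
Proof. by rewrite fcoefXM. Qed.

(* Hence fps_divX Q1dot is Q1dot / x, by Q1dot0 and fps_divXK, and the        *)
(* division by 1 - Q1dot / x is a genuine one.                                *)
Lemma denominator_unit : 1 - fps_divX Q1dot \is a GRing.unit.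
Proof.
rewrite fps_unitE; have -> : fcoef (1 - fps_divX Q1dot) 0 = 1 - fcoef Q1dot 1 by [].
have -> : fcoef Q1dot 1 = (nquad 1 1)%:R by rewrite fcoefXM.
by rewrite nquad11 subr0 unitr1.
Qed.

(* Main.v *)
Require Import Defs.
From HB Require Import structures.
From mathcomp Require Import all_boot all_order all_fingroup all_algebra.
From mathcomp Require Import boolp zify ring.

(******************************************************************************)
(* Tutte's deletion of the root edge, followed by the solution of the         *)
(* resulting recursion. A rooted map is given a leg x, an extra dart in its   *)
(* root corner; its root edge is {r, s} with r = v x and s = u r. If both     *)
(* sides of this edge lie in the root face, Euler's inequality shows that     *)
(* deleting it disconnects the map into two maps, with legs x and s;          *)
(* otherwise the root face absorbs a quadrangle. Labelled maps (the darts     *)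
(* other than the leg being numbered) are counted by explicit bijections, and *)
(* each isomorphism class of maps with e edges has (2e)! labellings. With W_p *)
(* the coefficient of y^p in Q this gives                                     *)
(*        W_(p+1) = W_(p+2) + sum_(a <= p) W_a W_(p-a),    W_0 = x,           *)
(* which, as W_p = O(x^(p+1)), has a unique solution. With R = x + 3 R^2 and  *)
(* C_p the Catalan numbers, it is                                             *)
(*        W_p = C_p R^(p+1) - (C_(p+1) + 2 C_p) R^(p+2).                      *)
(* Then x W_p' = (p+1) C_p x R^p, the quotient of the statement is R^2, and   *)
(* the claim is the recurrence (p+2) C_(p+1) = (4p+2) C_p.                    *)
(******************************************************************************)

Set Implicit Arguments.
Unset Strict Implicit.
Unset Printing Implicit Defensive.

Import GRing.Theory.

(** * Cycles and transpositions *)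

(** The engine is Tutte's deletion of the root edge. The leg makes both outcomes of a deletion
    objects of the same kind: [x] marks the corner where the root edge was, and the other dart [s]
    of that edge either becomes the leg of a second map or is removed too. Deleting or inserting an
    edge multiplies [v] and [u] by transpositions, hence also the face permutation
    ([add_edge_face]), and a transposition joins or splits cycles ([porbit_merge], [porbits_split]).

    Planarity is the extremal case of Euler's inequality ([euler_labelling], [leg_genus]). If both
    sides of the root edge lie in the root face, deletion keeps the vertices, loses an edge and
    gains a face; a connected result would violate the inequality ([bridge_split_s]). So there are
    two components, and their two inequalities add up to the equality for the whole map: both are
    planar ([bridge_split]). Otherwise the far side of the edge is a quadrangle, and deletion is
    undone by cutting three consecutive sides off a root face longer by 2 ([quad_split_third],
    [quad_glue_legged]).

    Distributing labels over two components gives binomial coefficients that cancel the numbers of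
    labellings ([map_count_rec]); unlabelled counts follow because a connected rooted map has no
    nontrivial automorphism ([relabel_inj]). The recursion [nquad_rec] determines all the series
    ([quad_seriesE]), and the Catalan convolution shows that the closed form satisfies it
    ([quad_closed_rec]). Since [R = x + 3 R^2], the derivatives collapse to monomials in [R]
    ([quad_closed_deriv]), and each coefficient of the claim becomes a polynomial identity in
    [R]. *)

Ltac cardlia := repeat (let k := fresh "k" in move: (#|_|) => k); lia.

Section Porbits.
Variable T : finType.
Implicit Types (s t v u : {perm T}) (A B : {set T}).

Lemma porbit_sub s B z :
  z \in B -> {in B, forall y, s y \in B} -> porbit s z \subset B.
Proof.
move=> zB sB; apply/subsetP=> _ /porbitP[i ->].
by elim: i => [|i IH]; rewrite ?perm1 // expgSr permM sB.
Qed.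

Lemma mem_porbitS s x y : (s y \in porbit s x) = (y \in porbit s x).
Proof. by rewrite -!eq_porbit_mem -{1}[s]expg1 (porbit_perm s 1). Qed.

Lemma porbit_fix s x : s x = x -> porbit s x = [set x].
Proof.
move=> sx; apply/eqP; rewrite eqEsubset sub1set porbit_id andbT.
by apply: porbit_sub => [|y]; rewrite !inE // => /eqP->; rewrite sx.
Qed.

Lemma porbit_disj s x y : y \notin porbit s x -> [disjoint porbit s x & porbit s y].
Proof.
move=> yx; rewrite -setI_eq0; apply: contraR yx => /set0Pn[z].
by rewrite inE -!eq_porbit_mem => /andP[/eqP-> /eqP->].
Qed.

Lemma porbit_eq_in s t x :
  {in porbit s x, forall y, t y = s y} -> porbit t x = porbit s x.
Proof.
move=> ts; have sub : porbit t x \subset porbit s x.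
  by apply: porbit_sub => [|y yx]; rewrite ?porbit_id // ts // mem_porbitS.
apply/eqP; rewrite eqEsubset sub; apply: porbit_sub => [|y yx]; first exact: porbit_id.
by rewrite -ts ?mem_porbitS // (subsetP sub).
Qed.

Section Merge.
Variables (s : {perm T}) (a b : T).
Hypothesis ab : b \notin porbit s a.
Let t := (tperm a b * s)%g.
Let U := porbit s a :|: porbit s b.

(** From [c] the product jumps to [s d] and then follows [s] until it reaches [d], meeting neither
    transposed point before that. *)
Let merge_half c d : d \notin porbit s c -> porbit s d \subset porbit (tperm c d * s)%g c.
Proof.
move=> dc; have e0 : s d \in porbit (tperm c d * s)%g c.
  by have := mem_porbit (tperm c d * s)%g 1 c; rewrite expg1 permM tpermL.
rewrite -[porbit s d](porbit_perm s 1 d) expg1.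
apply/subsetP => z /porbitP[i ->].
elim: i => [|i]; rewrite ?perm1 // expgSr permM.
have : ((s ^+ i)%g (s d)) \in porbit s d.
  by rewrite -eq_porbit_mem porbit_perm (porbit_perm s 1).
move: (_ (s d)) => y yd yi; have [->//|yNd] := eqVneq y d.
have yNc : y != c by apply: contraNneq dc => <-; rewrite porbit_sym.
by rewrite -(@tpermD _ c d y) 1?eq_sym // -permM mem_porbitS.
Qed.

Lemma porbit_merge z : porbit t z = if z \in U then U else porbit s z.
Proof.
have ba : a \notin porbit s b by rewrite porbit_sym.
have tba : (tperm b a * s)%g = t by rewrite tpermC.
have h1 := merge_half ab; have h2 := merge_half ba; rewrite tba -/t in h1 h2.
have eab : porbit t a = porbit t b.
  by apply/eqP; rewrite eq_porbit_mem (subsetP h2) ?porbit_id.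
have Uin : U \subset porbit t a by rewrite subUset h1 eab h2.
have Ut : {in U, forall y, t y \in U}.
  move=> y yU; rewrite /t permM !inE !mem_porbitS.
  by case: tpermP yU => [_|_|_ _]; rewrite ?porbit_id ?orbT // inE.
have EU : porbit t a = U.
  by apply/eqP; rewrite eqEsubset Uin porbit_sub // !inE porbit_id.
case: ifP => zU; first by rewrite -[RHS]EU; apply/eqP; rewrite eq_porbit_mem EU.
apply: porbit_eq_in => y yz; rewrite /t permM tpermD //;
  apply: contraFneq zU => E; rewrite -E in yz;
  by rewrite !inE ![z \in _]porbit_sym yz ?orbT.
Qed.

Lemma porbit_mergeL : porbit t a = U.
Proof. by rewrite porbit_merge !inE porbit_id. Qed.

Lemma porbits_merge : #|porbits t|.+1 = #|porbits s|.
Proof.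
have nab : a != b by apply: contraNneq ab => ->; exact: porbit_id.
have := porbits_mul_tperm s a b; rewrite /= -/t porbit_sym ab nab /=; lia.
Qed.
End Merge.

(** By parity of cycle counts: were [b] still on the cycle of [a], two multiplications by the same
    transposition would each add a cycle, although they cancel. *)
Lemma porbits_split s a b : b \in porbit s a -> a != b ->
  b \notin porbit (tperm a b * s)%g a.
Proof.
move=> ba nab; set t := (tperm a b * s)%g; apply/negP => bta.
have := porbits_mul_tperm s a b; have := porbits_mul_tperm t a b.
rewrite /= porbit_sym bta porbit_sym ba -/t [(_ * t)%g]mulgA tperm2 mul1g nab /=; lia.
Qed.

(* Euler's inequality for possibly disconnected maps: the number of values of *)
(* the invariant labelling f is a lower bound for the number of components.   *)
(* Multiplying u by a transposition that joins two of its cycles either keeps *)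
(* the labelling or merges two labels, and then also two cycles of u * v.     *)
Lemma euler_labelling v u : exists f : T -> T,
  [/\ forall z, f (v z) = f z, forall z, f (u z) = f z &
      #|porbits v| + #|porbits u| + #|porbits (u * v)%g| <= #|T| + 2 * #|f @: T|].
Proof.
have [n] := ubnP (#|T| - #|porbits u|); elim: n => // n IH in u *; rewrite ltnS => len.
(* For [u = 1] the components are the cycles of [v], each labelled by a chosen representative. *)
have [->|u1] := eqVneq u 1%g.
  pose f z := odflt z [pick y in porbit v z].
  have ff x y : porbit v x = porbit v y -> f x = f y.
    by rewrite /f => ->; case: pickP => // /(_ y); rewrite porbit_id.
  exists f; split=> [z|z|]; rewrite ?perm1 //.
    by apply: ff; rewrite -{1}[v]expg1 (porbit_perm v 1).
  have -> : #|porbits (1 : {perm T})%g| = #|T|.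
    rewrite card_imset // => x y; rewrite !porbit_fix ?perm1 //; exact: set1_inj.
  rewrite mul1g; suff -> : #|f @: T| = #|porbits v| by lia.
  rewrite -(card_in_imset (f := porbit v) (D := f @: T)) -?imset_comp.
    apply: eq_card => B; apply/imsetP/imsetP => -[z _ ->]; exists z => //=;
      rewrite /f; case: pickP => [y|/(_ z)]; rewrite ?porbit_id //;
      by rewrite /= -eq_porbit_mem => /eqP.
  move=> _ _ /imsetP[x _ ->] /imsetP[y _ ->] E; apply: ff; move: E.
  rewrite /f; case: pickP => [x'|/(_ x)]; rewrite ?porbit_id //.
  rewrite -eq_porbit_mem => /eqP->.
  case: pickP => [y'|/(_ y)]; rewrite ?porbit_id //.
  by rewrite -eq_porbit_mem => /eqP->.
have /existsP[x xu] : [exists x, u x != x].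
  apply: contraNT u1 => /existsPn ux; apply/eqP/permP => x.
  by rewrite perm1; apply/eqP; rewrite -[_ == _]negbK.
set y := u x in xu; pose u1' := (tperm x y * u)%g.
have uE : u = (tperm x y * u1')%g by rewrite /u1' mulgA tperm2 mul1g.
have xy : y \in porbit u x by rewrite /y mem_porbitS porbit_id.
have xNy : x != y by rewrite eq_sym.
have yx1 := porbits_split xy xNy.
have c1 := porbits_merge yx1; rewrite -/u1' -uE in yx1 c1.
have [|f [fv fu1 le]] := IH u1'.
  have : #|porbits u1'| <= #|T| by apply: leq_imset_card.
  lia.
have c2 := porbits_mul_tperm (u1' * v)%g x y.
rewrite /= mulgA -uE in c2.
have ft z : f (u z) = f (tperm x y z) by rewrite uE permM fu1.
have [fxy|fxy] := eqVneq (f x) (f y).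
  exists f; split=> // [z|]; first by rewrite ft; case: tpermP => // ->.
  move: c2 c1 le; rewrite xNy; case: (x \notin _) => /=; cardlia.
(* A cycle of [u1' * v] stays within one label class, so points with different labels lie on
   different cycles. *)
have xNy2 : x \notin porbit (u1' * v)%g y.
  apply: contra fxy => xy2.
  have /subsetP/(_ _ xy2) : porbit (u1' * v)%g y \subset [set z | f z == f y].
    by apply: porbit_sub => [|z]; rewrite !inE // permM fv fu1.
  by rewrite inE.
rewrite xNy2 xNy /= in c2.
exists (fun z => if f z == f y then f x else f z); split=> [z|z|].
- by rewrite fv.
- rewrite ft; case: tpermP => // ->; rewrite ?eqxx ?(negbTE fxy) //.
set g := fun z => _; suff : #|f @: T| <= #|g @: T|.+1 by move: c2 c1 le; cardlia.
have : f @: T \subset f y |: g @: T.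
  apply/subsetP => _ /imsetP[z _ ->]; rewrite !inE.
  case: eqP => //= fz; apply/imsetP; exists z => //; rewrite /g.
  by case: eqP fz.
by move/subset_leq_card; rewrite cardsU1; case: (_ \notin _) => /=; lia.
Qed.

End Porbits.

(** * Maps with a leg *)

Section Stable.
Variable T : finType.
Implicit Types (s t v u f : {perm T}) (A B S F : {set T}).

Definition stable s S := {in S, forall y, s y \in S}.

Lemma stable_iff s S : stable s S -> forall y, (s y \in S) = (y \in S).
Proof.
move=> sS y; apply/idP/idP => [syS|]; last exact: sS.
by apply: (subsetP (porbit_sub syS sS)); rewrite porbit_sym mem_porbitS porbit_id.
Qed.

Lemma stable_on A s : perm_on A s -> stable s A.
Proof. by move=> sA y; rewrite (perm_closed _ sA). Qed.

Lemma stableC s S : stable s S -> stable s (~: S).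
Proof. by move=> sS y; rewrite !inE (stable_iff sS). Qed.

Lemma stableU s S1 S2 : stable s S1 -> stable s S2 -> stable s (S1 :|: S2).
Proof. by move=> s1 s2 y; rewrite !inE => /orP[/s1|/s2]->; rewrite ?orbT. Qed.

Lemma stableI s S1 S2 : stable s S1 -> stable s S2 -> stable s (S1 :&: S2).
Proof. by move=> s1 s2 y; rewrite !inE => /andP[/s1-> /s2->]. Qed.

Lemma stableD s S1 S2 : stable s S1 -> stable s S2 -> stable s (S1 :\: S2).
Proof. by move=> s1 s2; rewrite setDE; apply: stableI => //; apply: stableC. Qed.

Lemma stableM s t S : stable s S -> stable t S -> stable (s * t)%g S.
Proof. by move=> sS tS y yS; rewrite permM tS ?sS. Qed.

Lemma stable_porbit s x : stable s (porbit s x).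
Proof. by move=> y; rewrite mem_porbitS. Qed.

Lemma porbit_stable s S y : stable s S -> y \in S -> porbit s y \subset S.
Proof. by move=> sS yS; apply: porbit_sub. Qed.

Lemma porbit_eq_on s t S : stable s S -> {in S, s =1 t} -> {in S, porbit t =1 porbit s}.
Proof.
move=> sS st y yS; apply: porbit_eq_in => z zy; apply/esym/st.
exact: (subsetP (porbit_stable sS yS)).
Qed.

Lemma card_porbits_uniform s S d : stable s S ->
  {in S, forall y, #|porbit s y| = d} -> #|porbit s @: S| * d = #|S|.
Proof.
move=> sS hd; suff partS : partition (porbit s @: S) S.
  by rewrite (card_uniform_partition (n := d) _ partS) // => _ /imsetP[y yS ->]; exact: hd.
suff -> : porbit s @: S = preim_partition (porbit s) S by exact: preim_partitionP.
have E x : x \in S -> [set y in S | porbit s x == porbit s y] = porbit s x.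
  move=> xS; apply/setP=> y; rewrite !inE eq_sym eq_porbit_mem andb_idl //.
  by apply: subsetP; apply: porbit_stable.
by apply/setP=> F; apply/imsetP/imsetP => -[x xS ->]; exists x; rewrite ?E.
Qed.

Lemma card_porbitsU s S1 S2 : stable s S1 -> [disjoint S1 & S2] ->
  #|porbit s @: (S1 :|: S2)| = #|porbit s @: S1| + #|porbit s @: S2|.
Proof.
move=> s1 dis; rewrite imsetU cardsU (_ : _ :&: _ = set0) ?cards0 ?subn0 //.
apply/eqP; rewrite -subset0; apply/subsetP => B; rewrite inE => /andP[].
case/imsetP => a aS -> /imsetP[b bS E].
have : b \in S1 by rewrite (subsetP (porbit_stable s1 aS)) // E porbit_id.
by move=> /(disjointFr dis); rewrite bS.
Qed.

Lemma card_porbitsD s S A : stable s S -> S \subset A ->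
  #|porbit s @: A| = #|porbit s @: S| + #|porbit s @: (A :\: S)|.
Proof.
move=> sS SA; rewrite -card_porbitsU //.
  by rewrite -{1}(setIidPr SA) setID.
by rewrite disjoint_sym disjoints_subset; apply/subsetP => y; rewrite !inE => /andP[].
Qed.

Lemma porbits_setT s : porbits s = porbit s @: [set: T].
Proof. by apply/setP => B; apply/imsetP/imsetP => -[y _ ->]; exists y. Qed.

Lemma card_porbits_on A s : perm_on A s ->
  #|porbits s| = #|porbit s @: A| + #|~: A|.
Proof.
move=> sA; rewrite porbits_setT (card_porbitsD (stable_on sA)) ?subsetT // setTD.
congr (_ + _); rewrite -[RHS](@card_porbits_uniform s _ 1) ?muln1 //.
  exact/stableC/stable_on.
by move=> y; rewrite inE => yA; rewrite porbit_fix ?cards1 ?(out_perm sA).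
Qed.

Definition component v u x := [set z | connect [rel a b | (b == v a) || (b == u a)] x z].

Section Component.
Variables (v u : {perm T}) (x : T).
Local Notation C := (component v u x).

Lemma component_id : x \in C. Proof. by rewrite inE connect0. Qed.

Lemma component_stablev : stable v C.
Proof.
by move=> y; rewrite !inE => /connect_trans; apply; apply: connect1; rewrite /= eqxx.
Qed.

Lemma component_stableu : stable u C.
Proof.
by move=> y; rewrite !inE => /connect_trans; apply; apply: connect1; rewrite /= eqxx orbT.
Qed.

Lemma component_sub B : x \in B -> stable v B -> stable u B -> C \subset B.
Proof.
move=> xB vB uB; apply/subsetP => z; rewrite inE => /connectP[p + ->].
elim: p x xB => //= y p IH a aB /andP[ay]; apply: IH.
by case/orP: ay => /eqP->; [apply: vB|apply: uB].
Qed.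
End Component.

(** Connectedness through invariant sets: it transfers between a map and its pieces by intersecting
    or enlarging the set, with no paths to follow. *)
Definition connected_on A x v u :=
  forall B, x \in B -> stable v B -> stable u B -> A \subset B.

(** On [A] the invariant labelling is constant. The points outside [A] are fixed by all three
    permutations; each adds three cycles and at most one label, which balances in
    [euler_labelling]. *)
Lemma euler_connected A x v u : x \in A -> perm_on A v -> perm_on A u ->
  connected_on A x v u ->
  #|porbit v @: A| + #|porbit u @: A| + #|porbit (u * v)%g @: A| <= #|A| + 2.
Proof.
move=> xA vA uA conn; have [f [fv fu]] := euler_labelling v u.
rewrite (card_porbits_on vA) (card_porbits_on uA) (card_porbits_on (perm_onM uA vA)).
suff : #|f @: T| <= 1 + #|~: A| by have := cardsC A; cardlia.
have AB : A \subset [set z | f z == f x].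
  by apply: conn => [|y|y]; rewrite !inE ?eqxx // ?fv ?fu.
apply: (@leq_trans #|f x |: (f @: (~: A))|).
  apply/subset_leq_card/subsetP => _ /imsetP[z _ ->]; rewrite !inE.
  case zA: (z \in A); first by have := subsetP AB _ zA; rewrite inE => ->.
  by rewrite [_ \in f @: _]imset_f ?orbT // inE zA.
rewrite cardsU1; apply: leq_add; first by case: (_ \notin _).
exact: leq_imset_card.
Qed.

Lemma card_porbits_involution A F u : F \subset A ->
  (forall y, u (u y) = y) -> (forall y, (u y == y) = (y \notin A :\: F)) ->
  2 * #|porbit u @: A| = #|A| + #|F|.
Proof.
move=> FA uu fix_u.
have uF y : y \in F -> u y = y by move=> yF; apply/eqP; rewrite fix_u !inE yF.
have sF : stable u F by move=> y yF; rewrite uF.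
have sA : stable u A.
  move=> y yA; apply: contraLR yA => uyA.
  have /eqP E : u (u y) == u y by rewrite fix_u !inE negb_and uyA orbT.
  by rewrite -(uu y) E.
have sD := stableD sA sF.
have cF : #|porbit u @: F| * 1 = #|F|.
  by apply: card_porbits_uniform => // y yF; rewrite porbit_fix ?cards1 ?uF.
have cD : #|porbit u @: (A :\: F)| * 2 = #|A :\: F|.
  apply: card_porbits_uniform => // y yD.
  suff -> : porbit u y = [set y; u y].
    by rewrite cards2 eq_sym fix_u yD.
  apply/eqP; rewrite eqEsubset; apply/andP; split.
    by apply: porbit_sub => [|z]; rewrite !inE ?eqxx // => /orP[]/eqP->; rewrite ?uu eqxx ?orbT.
  by apply/subsetP => z; rewrite !inE => /orP[]/eqP->; rewrite ?mem_porbitS porbit_id.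
rewrite (card_porbitsD sF FA) -(cardsID F A) (setIidPr FA); move: cF cD; cardlia.
Qed.

Lemma card_faces A S f : stable f A -> stable f S -> S \subset A ->
  (forall y, y \in A -> y \notin S -> #|porbit f y| = 4) ->
  4 * #|porbit f @: A| + #|S| = 4 * #|porbit f @: S| + #|A|.
Proof.
move=> fA fS SA face; have c : #|porbit f @: (A :\: S)| * 4 = #|A :\: S|.
  by apply: card_porbits_uniform => [|y]; [exact: stableD | rewrite inE => /andP[? ?]; exact: face].
rewrite (card_porbitsD fS SA) -(cardsID S A) (setIidPr SA); move: c; cardlia.
Qed.

Lemma card_imset_porbit f x : #|porbit f @: porbit f x| = 1.
Proof.
rewrite (_ : _ @: _ = [set porbit f x]) ?cards1 //.
apply/setP => B; rewrite inE; apply/imsetP/eqP => [[y yx ->]|->].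
  by apply/eqP; rewrite eq_porbit_mem.
by exists x; rewrite ?porbit_id.
Qed.

End Stable.

(* A rooted map with its root carried by a leg: x is an extra dart, fixed by  *)
(* the edge involution u and inserted in the root corner, and v x is the root *)
(* dart. The leg adds 1 to the degree of the root face. The single-vertex map *)
(* is the case A = [set x].                                                   *)
Record legged (T : finType) (A : {set T}) (x : T) (p : nat) (v u : {perm T}) : Prop :=
  Legged {
    leg_in : x \in A;
    leg_on : perm_on A v;
    leg_inv : forall y, u (u y) = y;
    leg_fix : forall y, (u y == y) = (y \notin A :\ x);
    leg_conn : connected_on A x v u;
    leg_root : #|porbit (u * v)%g x| = p.*2.+1;
    leg_face : forall y, y \in A -> y \notin porbit (u * v)%g x -> #|porbit (u * v)%g y| = 4
  }.

(* Euler's formula, with #|A| = 2e + 1 and the number of faces read off their *)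
(* degrees.                                                                   *)
Definition planar_leg (T : finType) (A : {set T}) (p : nat) (v : {perm T}) : Prop :=
  4 * #|porbit v @: A| = #|A| + 2 * p + 3.

Definition leg_maps (T : finType) (A : {set T}) (x : T) (p : nat) : {set {perm T} * {perm T}} :=
  [set m | `[< legged A x p m.1 m.2 /\ planar_leg A p m.1 >]].

Lemma leg_mapsP (T : finType) (A : {set T}) (x : T) (p : nat) (m : {perm T} * {perm T}) :
  reflect (legged A x p m.1 m.2 /\ planar_leg A p m.1) (m \in leg_maps A x p).
Proof. by rewrite inE; exact: asboolP. Qed.

Section LegTheory.
Variables (T : finType) (A : {set T}) (x : T) (p : nat) (v u : {perm T}).
Hypothesis M : legged A x p v u.

Lemma leg_onu : perm_on A u.
Proof.
apply/subsetP => y; rewrite inE /=; apply: contraNT => yA.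
by rewrite (leg_fix M) !inE negb_and yA orbT.
Qed.

Lemma leg_ux : u x = x.
Proof. by apply/eqP; rewrite (leg_fix M) !inE eqxx. Qed.

Lemma leg_stablef : stable (u * v)%g A.
Proof. by apply: stableM; apply: stable_on; [exact: leg_onu|exact: leg_on M]. Qed.

Lemma leg_rootS : porbit (u * v)%g x \subset A.
Proof. exact: porbit_stable leg_stablef (leg_in M). Qed.

Lemma leg_oddA : odd #|A|.
Proof.
have := @card_porbits_involution _ A [set x] u _ (leg_inv M) (leg_fix M).
by rewrite sub1set (leg_in M) cards1 => /(_ isT); cardlia.
Qed.

(** Euler's inequality with edges and faces counted from their degrees; [planar_leg] is the case of
    equality. *)
Lemma leg_genus : 4 * #|porbit v @: A| <= #|A| + 2 * p + 3.
Proof.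
have := euler_connected (leg_in M) (leg_on M) leg_onu (leg_conn M).
have := @card_porbits_involution _ A [set x] u _ (leg_inv M) (leg_fix M).
rewrite sub1set (leg_in M) cards1 => /(_ isT).
have := card_faces leg_stablef (@stable_porbit _ _ x) leg_rootS (leg_face M).
rewrite card_imset_porbit (leg_root M) -mul2n; cardlia.
Qed.
End LegTheory.

(** * Bridges *)

Section Glue.
Variables (T : finType) (A1 A2 : {set T}) (s1 s2 : {perm T}).
Hypotheses (dis : [disjoint A1 & A2]) (s1A : perm_on A1 s1) (s2A : perm_on A2 s2).

Lemma glueL : {in A1, s1 =1 (s1 * s2)%g}.
Proof.
move=> y yA; rewrite permM (out_perm s2A) //.
by rewrite (disjointFr dis) // (perm_closed _ s1A).
Qed.

Lemma glueR : {in A2, s2 =1 (s1 * s2)%g}.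
Proof. by move=> y yA; rewrite permM (out_perm s1A) // (disjointFl dis). Qed.

Lemma glue_on : perm_on (A1 :|: A2) (s1 * s2)%g.
Proof.
apply: perm_onM; [apply: subset_trans s1A _|apply: subset_trans s2A _];
  [exact: subsetUl|exact: subsetUr].
Qed.
End Glue.
Arguments glueR {T A1 A2 s1 s2} dis s1A [x].

Lemma stable_tperm (T : finType) (B : {set T}) a b : a \in B -> b \in B -> stable (tperm a b) B.
Proof. by move=> aB bB y yB; case: tpermP. Qed.

(** * Inserting an edge into a map *)

Section AddEdge.
Variables (T : finType) (x r s : T) (v' u' : {perm T}).
Hypotheses (vr : v' r = r) (ur : u' r = r) (ux : u' x = x) (us : u' s = s).
Hypotheses (xNr : x != r) (sNr : s != r) (xNs : x != s).
Let v := (tperm r x * v')%g.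
Let u := (tperm r s * u')%g.
Let f' := (u' * v')%g.
Let f := (u * v)%g.

(** The involution [u'] fixes [r] and [x], so it commutes with [tperm r x]. The inner transposition
    puts [r] on the face of [x]; the outer one then joins or splits faces according to where [s]
    lies. *)
Lemma add_edge_face : f = (tperm r s * (tperm r x * f'))%g.
Proof.
rewrite /f /u /v /f' -!mulgA; congr (_ * _)%g; rewrite !mulgA; congr (_ * _)%g.
by rewrite [RHS]conjgC tpermJ ur ux.
Qed.

Lemma add_edge_fr : f' r = r. Proof. by rewrite permM ur vr. Qed.

Lemma add_edge_porbit_mid z : porbit (tperm r x * f')%g z =
  if z \in r |: porbit f' x then r |: porbit f' x else porbit f' z.
Proof.
have rx : x \notin porbit f' r by rewrite porbit_fix ?add_edge_fr // inE.
by rewrite (porbit_merge rx) (porbit_fix add_edge_fr).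
Qed.

Lemma add_edge_porbits_vertex : #|porbits v|.+1 = #|porbits v'|.
Proof. by apply: porbits_merge; rewrite porbit_fix // inE. Qed.

Lemma add_edge_vx : v x = r. Proof. by rewrite permM tpermR. Qed.
Lemma add_edge_ur : u r = s. Proof. by rewrite permM tpermL. Qed.

Lemma add_edge_inv : (forall y, u' (u' y) = y) -> forall y, u (u y) = y.
Proof.
move=> uu y; have comm : commute (tperm r s) u'.
  by rewrite /commute conjgC tpermJ ur us.
by rewrite -permM /u -mulgA (mulgA u') -comm -mulgA mulgA tperm2 mul1g permM uu.
Qed.

Lemma add_edge_fix (A : {set T}) : r \in A -> s \in A ->
  (forall y, (u' y == y) = (y \notin A :\ r :\ x :\ s)) ->
  forall y, (u y == y) = (y \notin A :\ x).
Proof.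
move=> rA sA fx y; rewrite permM !inE; case: tpermP => [->|->|/eqP yr /eqP ys].
- by rewrite us (negbTE sNr) rA eq_sym xNr.
- by rewrite ur eq_sym (negbTE sNr) sA eq_sym xNs.
- by rewrite fx !inE yr ys.
Qed.

Section Bridge.
Hypothesis sx : s \notin porbit f' x.
Let U := r |: (porbit f' x :|: porbit f' s).

(** With [s] off the face of [x] both transpositions join cycles: the two faces and [r] form the
    single face [U], which has the new edge on both sides. *)
Lemma bridge_porbit z : porbit f z = if z \in U then U else porbit f' z.
Proof.
have sNU : s \notin r |: porbit f' x by rewrite !inE (negbTE sx) orbF.
have sr : s \notin porbit (tperm r x * f')%g r.
  by rewrite add_edge_porbit_mid !inE eqxx /= !inE (negbTE sx) orbF.
rewrite add_edge_face (porbit_merge sr) !add_edge_porbit_mid (negbTE sNU).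
rewrite !inE eqxx /= !inE -!orbA -setUA -/U; case: ifP => // /negbT.
by rewrite !negb_or => /and3P[/negbTE-> /negbTE-> _].
Qed.

Lemma card_bridge : #|U| = (#|porbit f' x| + #|porbit f' s|).+1.
Proof.
have dis : [disjoint porbit f' x & porbit f' s] by apply: porbit_disj.
have fr y : r \in porbit f' y -> y = r.
  rewrite porbit_sym porbit_fix ?add_edge_fr // => /set1P //.
rewrite /U cardsU1 cardsU (disjoint_setI0 dis) cards0 subn0.
rewrite !inE; case: (boolP (r \in _)) => [/fr|_] /=; first by move/eqP: xNr.
by case: (boolP (r \in _)) => [/fr|_] //=; move/eqP: sNr.
Qed.
End Bridge.
End AddEdge.

Section Vertices.
Variables (T : finType) (A : {set T}) (x r : T) (v : {perm T}).
Hypotheses (rA : r \in A) (xA : x \in A) (xNr : x != r).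

Lemma perm_on_tperm2 a b : a \in A -> b \in A -> perm_on A (tperm a b).
Proof.
move=> aA bA; apply: subset_trans (tperm_on a b) _.
by apply/subsetP => y; rewrite !inE => /orP[]/eqP->.
Qed.

Lemma perm_onD1 w : perm_on A w -> w r = r -> perm_on (A :\ r) w.
Proof.
move=> wA wr; apply/subsetP => y; rewrite !inE => wy.
rewrite (subsetP wA) ?inE // andbT; apply: contraNneq wy => ->; exact/eqP.
Qed.

Lemma perm_onU1 w : perm_on (A :\ r) w -> perm_on A w /\ w r = r.
Proof.
move=> wA; split; first by apply: subset_trans wA (subD1set _ _).
by rewrite (out_perm wA) // !inE eqxx.
Qed.

(** The dart [r] joins the vertex of [x], so no vertex appears or disappears. *)
Lemma card_vertices_insert v' : perm_on (A :\ r) v' ->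
  #|porbit (tperm r x * v')%g @: A| = #|porbit v' @: (A :\ r)|.
Proof.
move=> on'; have [on vr] := perm_onU1 on'.
have := card_porbits_on (perm_onM (perm_on_tperm2 rA xA) on).
have := card_porbits_on on'.
have := @add_edge_porbits_vertex _ x r v' vr xNr.
have := cardsC A; have := cardsC (A :\ r); have := cardsD1 r A; rewrite rA; cardlia.
Qed.
End Vertices.


Section GlueFace.
Variables (T : finType) (A1 A2 : {set T}) (v1 u1 v2 u2 : {perm T}).
Hypotheses (dis : [disjoint A1 & A2]).
Hypotheses (v1A : perm_on A1 v1) (v2A : perm_on A2 v2) (u1A : perm_on A1 u1) (u2A : perm_on A2 u2).
Let f' := (u1 * u2 * (v1 * v2))%g.

Lemma glue_faceL : {in A1, (u1 * v1)%g =1 f'}.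
Proof.
move=> y yA; have uyA : u1 y \in A1 by rewrite (perm_closed _ u1A).
by rewrite [f' y]permM -(glueL dis u1A u2A yA) -(glueL dis v1A v2A uyA) permM.
Qed.

Lemma glue_faceR : {in A2, (u2 * v2)%g =1 f'}.
Proof.
move=> y yA; have uyA : u2 y \in A2 by rewrite (perm_closed _ u2A).
by rewrite [f' y]permM -(glueR dis u1A yA) -(glueR dis v1A uyA) permM.
Qed.
End GlueFace.
Arguments glue_faceR {T A1 A2 v1 u1 v2 u2} dis v1A u1A u2A [x].

Section BridgeGlue.
Variables (T : finType) (A A1 A2 : {set T}) (x r s : T) (a b : nat).
Variables (v1 u1 v2 u2 : {perm T}).
Hypotheses (rA : r \in A) (defA : A1 :|: A2 = A :\ r) (dis : [disjoint A1 & A2]).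
Hypotheses (M1 : legged A1 x a v1 u1) (M2 : legged A2 s b v2 u2).
Let v' := (v1 * v2)%g.
Let u' := (u1 * u2)%g.
Let v := (tperm r x * v')%g.
Let u := (tperm r s * u')%g.
Let f' := (u' * v')%g.
Let f := (u * v)%g.

Let A1r : A1 \subset A :\ r. Proof. by rewrite -defA subsetUl. Qed.
Let A2r : A2 \subset A :\ r. Proof. by rewrite -defA subsetUr. Qed.
Let x1 : x \in A1 := leg_in M1.
Let s2 : s \in A2 := leg_in M2.
Let von : perm_on (A :\ r) v'. Proof. by rewrite -defA; exact: glue_on (leg_on M1) (leg_on M2). Qed.
Let uon : perm_on (A :\ r) u'. Proof. by rewrite -defA; exact: glue_on (leg_onu M1) (leg_onu M2). Qed.
Let vr : v' r = r. Proof. by rewrite (out_perm von) // !inE eqxx. Qed.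
Let ur : u' r = r. Proof. by rewrite (out_perm uon) // !inE eqxx. Qed.
Let ux : u' x = x. Proof. by rewrite -(glueL dis (leg_onu M1) (leg_onu M2) x1) (leg_ux M1). Qed.
Let us : u' s = s. Proof. by rewrite -(glueR dis (leg_onu M1) s2) (leg_ux M2). Qed.
Let xNr : x != r. Proof. by have := subsetP A1r _ x1; rewrite !inE => /andP[]. Qed.
Let sNr : s != r. Proof. by have := subsetP A2r _ s2; rewrite !inE => /andP[]. Qed.
Let xA : x \in A. Proof. by have := subsetP A1r _ x1; rewrite !inE => /andP[]. Qed.
Let sA : s \in A. Proof. by have := subsetP A2r _ s2; rewrite !inE => /andP[]. Qed.
Let xNs : x != s. Proof. by apply: contraTneq s2 => <-; rewrite (disjointFr dis). Qed.

Let f1on : {in A1, porbit f' =1 porbit (u1 * v1)%g}.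
Proof.
apply: porbit_eq_on (leg_stablef M1) _.
exact: (glue_faceL dis (leg_on M1) (leg_on M2) (leg_onu M1) (leg_onu M2)).
Qed.

Let f2on : {in A2, porbit f' =1 porbit (u2 * v2)%g}.
Proof.
apply: porbit_eq_on (leg_stablef M2) _.
exact: (glue_faceR dis (leg_on M1) (leg_onu M1) (leg_onu M2)).
Qed.

Lemma bridge_glue_root : porbit f' x = porbit (u1 * v1)%g x. Proof. exact: f1on. Qed.

Lemma bridge_glue_sx : s \notin porbit f' x.
Proof.
rewrite bridge_glue_root; apply: contraL s2 => /(subsetP (leg_rootS M1)) s1.
by rewrite (disjointFr dis).
Qed.
Let sx := bridge_glue_sx.

Lemma bridge_glue_vx : v x = r. Proof. exact: add_edge_vx. Qed.
Lemma bridge_glue_ur : u r = s. Proof. exact: add_edge_ur. Qed.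

(** This lets the dart set of the first piece be read off the glued map, so that gluing and
    splitting are inverse to each other. *)
Lemma bridge_glue_component : component v' u' x = A1.
Proof.
apply/eqP; rewrite eqEsubset; apply/andP; split.
  apply: component_sub => // y yA.
    by rewrite -(glueL dis (leg_on M1) (leg_on M2) yA) (perm_closed _ (leg_on M1)).
  by rewrite -(glueL dis (leg_onu M1) (leg_onu M2) yA) (perm_closed _ (leg_onu M1)).
suff : A1 \subset component v' u' x :&: A1 by rewrite subsetI => /andP[].
apply: (leg_conn M1) => [|y|y]; rewrite inE ?component_id // => /andP[yC yA];
  rewrite inE.
  rewrite (perm_closed _ (leg_on M1)) yA (glueL dis (leg_on M1) (leg_on M2) yA).
  by rewrite component_stablev.
rewrite (perm_closed _ (leg_onu M1)) yA (glueL dis (leg_onu M1) (leg_onu M2) yA).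
by rewrite component_stableu.
Qed.

Lemma bridge_glue_vertices :
  #|porbit v @: A| = #|porbit v1 @: A1| + #|porbit v2 @: A2|.
Proof.
rewrite (card_vertices_insert rA xA xNr von) -defA.
have e1 : {in A1, porbit v' =1 porbit v1}.
  exact: porbit_eq_on (stable_on (leg_on M1)) (glueL dis (leg_on M1) (leg_on M2)).
have e2 : {in A2, porbit v' =1 porbit v2}.
  exact: porbit_eq_on (stable_on (leg_on M2)) (glueR dis (leg_on M1)).
rewrite card_porbitsU ?(eq_in_imset e1) ?(eq_in_imset e2) // => y yA.
by rewrite -(glueL dis (leg_on M1) (leg_on M2) yA) (perm_closed _ (leg_on M1)).
Qed.

(** The root face consists of [r] and the two old root faces: [(2a+1) + (2b+1) + 1 = 2(a+b+1) + 1].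
    Every other face lies in one piece and is unchanged. *)
Lemma bridge_glue_legged : legged A x (a + b).+1 v u.
Proof.
have fP := bridge_porbit vr ur ux xNr sNr sx; rewrite -/f -/f' in fP.
have [vA _] := perm_onU1 von; have [uA_ _] := perm_onU1 uon.
split=> //.
- exact: perm_onM (perm_on_tperm2 rA xA) vA.
- apply: add_edge_inv => // y; rewrite -permM.
  have comm := perm_onC (leg_onu M1) (leg_onu M2) dis.
  rewrite /u' -mulgA (mulgA u2) -comm !mulgA.
  by rewrite !permM (leg_inv M1) (leg_inv M2).
- apply: add_edge_fix => // y; have := congr1 (fun B : {set T} => y \in B) defA.
  rewrite !inE; case: (boolP (y \in A1)) => [yA|yA1].
    rewrite /= -(glueL dis (leg_onu M1) (leg_onu M2) yA) (leg_fix M1) !inE yA => <-.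
    rewrite !andbT; suff -> : y != s by []. 
    by apply: contraTneq s2 => <-; rewrite (disjointFr dis yA).
  case: (boolP (y \in A2)) => [yA|yA2] /= <-.
    rewrite -(glueR dis (leg_onu M1) yA) (leg_fix M2) !inE yA.
    suff -> : y != x by rewrite !andbT.
    by apply: contraNneq yA1 => ->.
  rewrite !andbF (out_perm uon) ?eqxx // -defA !inE negb_or yA1 //.
- move=> B xB vB uB.
  have rB : r \in B by rewrite -(add_edge_vx x vr); exact: vB.
  have sB : s \in B by rewrite -(add_edge_ur r us); exact: uB.
  (* A set containing both transposed darts is stable under the transposition, hence under the
     permutation without it. *)
  have vB' : stable v' B.
    rewrite -[v']mul1g -(tperm2 r x) -mulgA.
    by apply: stableM => //; exact: stable_tperm.
  have uB' : stable u' B.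
    rewrite -[u']mul1g -(tperm2 r s) -mulgA.
    by apply: stableM => //; exact: stable_tperm.
  have A1B : A1 \subset B.
    suff : A1 \subset B :&: A1 by rewrite subsetI => /andP[].
    apply: (leg_conn M1) => [|y|y]; rewrite !inE ?xB ?x1 // => /andP[yB yA].
      by rewrite (perm_closed _ (leg_on M1)) yA (glueL dis (leg_on M1) (leg_on M2) yA) vB'.
    by rewrite (perm_closed _ (leg_onu M1)) yA (glueL dis (leg_onu M1) (leg_onu M2) yA) uB'.
  have A2B : A2 \subset B.
    suff : A2 \subset B :&: A2 by rewrite subsetI => /andP[].
    apply: (leg_conn M2) => [|y|y]; rewrite !inE ?sB ?s2 // => /andP[yB yA].
      by rewrite (perm_closed _ (leg_on M2)) yA (glueR dis (leg_on M1) yA) vB'.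
    by rewrite (perm_closed _ (leg_onu M2)) yA (glueR dis (leg_onu M1) yA) uB'.
  by rewrite -(setD1K rA) subUset sub1set rB -defA subUset A1B.
- rewrite -/f fP !inE porbit_id orbT card_bridge // f1on // f2on //.
  rewrite (leg_root M1) (leg_root M2); clear; lia.
- move=> y yA; rewrite -/f (fP x) !inE porbit_id orbT /= => yU; rewrite fP (negbTE yU).
  move: yU; rewrite !inE !negb_or => /and3P[yr yx ys].
  have : y \in A1 :|: A2 by rewrite defA !inE yr.
  rewrite inE => /orP[yA1|yA2].
    by rewrite f1on // (leg_face M1) // -f1on.
  by rewrite f2on // (leg_face M2) // -f2on.
Qed.
End BridgeGlue.

Section Restrict.
Variables (T : finType) (S : {set T}) (w : {perm T}).
Hypothesis wS : stable w S.

Lemma restrE : {in S, restr_perm S w =1 w}.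
Proof.
have wN : w \in 'N(S | 'P)%g by rewrite !inE /=; apply/subsetP => y yS; rewrite inE /=; exact: wS.
by move=> y yS; rewrite restr_permE.
Qed.
End Restrict.

(** * Deleting the root edge *)

Section RemoveEdge.
Variables (T : finType) (A : {set T}) (x r s : T) (p : nat) (v u : {perm T}).
Hypotheses (M : legged A x p v u) (vx : v x = r) (urs : u r = s) (xNr : x != r).
Let v' := (tperm r x * v)%g.
Let u' := (tperm r s * u)%g.
Let f' := (u' * v')%g.
Let f := (u * v)%g.

Lemma rem_edge_v : v = (tperm r x * v')%g. Proof. by rewrite mulgA tperm2 mul1g. Qed.
Lemma rem_edge_u : u = (tperm r s * u')%g. Proof. by rewrite mulgA tperm2 mul1g. Qed.
Lemma rem_edge_rA : r \in A. Proof. by rewrite -vx (perm_closed _ (leg_on M)) (leg_in M). Qed.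
Let rA := rem_edge_rA.
Lemma rem_edge_sA : s \in A. Proof. by rewrite -urs (perm_closed _ (leg_onu M)). Qed.
Let sA := rem_edge_sA.
Lemma rem_edge_us0 : u s = r. Proof. by rewrite -urs (leg_inv M). Qed.
Lemma rem_edge_sNr : s != r.
Proof. by rewrite -urs (leg_fix M) !inE rA andbT negbK eq_sym (negbTE xNr). Qed.
Let sNr := rem_edge_sNr.
Lemma rem_edge_xNs : x != s.
Proof. by apply: contraNneq xNr => E; rewrite -rem_edge_us0 -E (leg_ux M). Qed.
Let xNs := rem_edge_xNs.
Lemma rem_edge_vr : v' r = r. Proof. by rewrite permM tpermL. Qed.
Lemma rem_edge_ur : u' r = r. Proof. by rewrite permM tpermL rem_edge_us0. Qed.
Lemma rem_edge_us : u' s = s. Proof. by rewrite permM tpermR. Qed.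
Lemma rem_edge_ux : u' x = x.
Proof. by rewrite permM tpermD 1?eq_sym ?(leg_ux M). Qed.
Lemma rem_edge_von : perm_on (A :\ r) v'.
Proof.
apply: perm_onD1 rem_edge_vr.
exact: perm_onM (perm_on_tperm2 rA (leg_in M)) (leg_on M).
Qed.
Lemma rem_edge_uon : perm_on (A :\ r) u'.
Proof.
apply: perm_onD1 rem_edge_ur.
exact: perm_onM (perm_on_tperm2 rA sA) (leg_onu M).
Qed.
Lemma rem_edge_inv y : u' (u' y) = y.
Proof.
have comm : commute (tperm r s) u.
  by rewrite /commute conjgC tpermJ urs rem_edge_us0 tpermC.
by rewrite -permM /u' -mulgA (mulgA u) -comm -mulgA mulgA tperm2 mul1g permM (leg_inv M).
Qed.
Lemma rem_edge_fix y : (u' y == y) = (y \notin A :\ r :\ x :\ s).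
Proof.
rewrite permM !inE; case: tpermP => [->|->|/eqP yr /eqP ys].
- by rewrite rem_edge_us0 !eqxx /= !andbF.
- by rewrite urs !eqxx.
- by rewrite (leg_fix M) !inE yr ys.
Qed.

Lemma rem_edge_vertices : #|porbit v @: A| = #|porbit v' @: (A :\ r)|.
Proof.
by rewrite {1}rem_edge_v (card_vertices_insert rA (leg_in M) xNr rem_edge_von).
Qed.

Lemma rem_edge_vAr : stable v' (A :\ r). Proof. exact: stable_on rem_edge_von. Qed.
Lemma rem_edge_uAr : stable u' (A :\ r). Proof. exact: stable_on rem_edge_uon. Qed.

(** After the deletion every dart other than [r] is still reached from [x] or from [s]: adding [r]
    to [B] makes it stable under the original permutations. *)
Lemma rem_edge_conn (B : {set T}) : x \in B -> s \in B -> stable v' B -> stable u' B -> A \subset r |: B.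
Proof.
move=> xB sB vB uB; apply: (leg_conn M); first by rewrite !inE xB orbT.
- rewrite rem_edge_v; apply: stableM; first by apply: stable_tperm; rewrite !inE ?eqxx ?xB ?orbT.
  by move=> y; rewrite !inE => /orP[/eqP->|/vB->]; rewrite ?rem_edge_vr ?eqxx ?orbT.
- rewrite rem_edge_u; apply: stableM; first by apply: stable_tperm; rewrite !inE ?eqxx ?sB ?orbT.
  by move=> y; rewrite !inE => /orP[/eqP->|/uB->]; rewrite ?rem_edge_ur ?eqxx ?orbT.
Qed.

Section BridgeSplit.
Hypotheses (Pl : planar_leg A p v) (sx : s \notin porbit f' x).
Let C := component v' u' x.
Let D := A :\ r :\: C.

Let fP z := @bridge_porbit T x r s v' u' rem_edge_vr rem_edge_ur rem_edge_ux xNr sNr sx z.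

Let E_f : f = (tperm r s * u' * (tperm r x * v'))%g.
Proof. by rewrite -rem_edge_v -rem_edge_u. Qed.

Let xAr : x \in A :\ r. Proof. by rewrite !inE xNr (leg_in M). Qed.
Let sAr : s \in A :\ r. Proof. by rewrite !inE sNr. Qed.
Let CA : C \subset A :\ r.
Proof. apply: component_sub => //; [exact: rem_edge_vAr|exact: rem_edge_uAr]. Qed.
Let vC : stable v' C := @component_stablev _ v' u' x.
Let uC : stable u' C := @component_stableu _ v' u' x.
Let xC : x \in C := @component_id _ v' u' x.
Let vD : stable v' D := stableD rem_edge_vAr vC.
Let uD : stable u' D := stableD rem_edge_uAr uC.
Let fAr : stable f' (A :\ r) := stableM rem_edge_uAr rem_edge_vAr.

Let root_sum : #|porbit f' x| + #|porbit f' s| = 2 * p.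
Proof.
have := leg_root M; rewrite -/f E_f fP !inE porbit_id orbT.
rewrite (card_bridge rem_edge_vr rem_edge_ur xNr sNr sx) -/f' => -[->].
by rewrite mul2n.
Qed.

Let face' y : y \in A :\ r -> y \notin porbit f' x -> y \notin porbit f' s ->
  #|porbit f' y| = 4.
Proof.
rewrite !inE => /andP[yr yA] yx ys.
have e z := fP z; rewrite -E_f -/f' in e.
set U := r |: (porbit f' x :|: porbit f' s) in e.
have yU : y \notin U by rewrite !inE !negb_or yr yx ys.
have xU : x \in U by rewrite !inE porbit_id orbT.
by have := leg_face M yA; rewrite -/f (e x) xU yU (e y) (negbTE yU); apply.
Qed.

(** Otherwise the map without the edge is connected. It has the same vertices, one edge fewer and
    one face more, so its Euler characteristic would be 4. *)
Lemma bridge_split_s : s \notin C.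
Proof.
apply/negP => sC.
have conn : connected_on (A :\ r) x v' u'.
  move=> B xB vB uB.
  have sB : s \in B by apply: (subsetP (component_sub xB vB uB)).
  have := rem_edge_conn xB sB vB uB => /subsetP AB.
  apply/subsetP => y; rewrite !inE => /andP[yr /AB]; by rewrite !inE (negbTE yr).
have eul := euler_connected xAr rem_edge_von rem_edge_uon conn.
(* Two darts are now unmatched, the leg [x] and the widowed [s]. *)
have inv : 2 * #|porbit u' @: (A :\ r)| = #|A :\ r| + #|[set x; s]|.
  apply: card_porbits_involution => [|y|y]; last 2 first.
  - exact: rem_edge_inv.
  - by rewrite rem_edge_fix !inE negb_or; case: (y == x); rewrite /= ?andbF.
  - by apply/subsetP => y; rewrite !inE => /orP[]/eqP->; rewrite ?xNr ?sNr ?(leg_in M) ?sA.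
have dis := porbit_disj sx.
have fS : stable f' (porbit f' x :|: porbit f' s) by apply: stableU; exact: stable_porbit.
have := card_faces fAr fS.
rewrite subUset !porbit_stable // => /(_ isT).
rewrite cardsU (disjoint_setI0 dis) cards0 subn0 root_sum.
rewrite card_porbitsU //; last exact: stable_porbit.
rewrite !card_imset_porbit.
have fc y : y \in A :\ r -> y \notin porbit f' x :|: porbit f' s -> #|porbit f' y| = 4.
  by move=> yA; rewrite inE negb_or => /andP[]; exact: face'.
move=> /(_ fc); move: Pl; rewrite /planar_leg rem_edge_vertices.
move: eul inv; rewrite cards2 xNs (cardsD1 r A) rA -/f'; clear; cardlia.
Qed.

Let sD : s \in D. Proof. by rewrite inE bridge_split_s. Qed.

Lemma bridge_split_porbits :
  #|porbit v @: A| = #|porbit v' @: C| + #|porbit v' @: D|.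
Proof. by rewrite rem_edge_vertices (card_porbitsD vC CA). Qed.

Let restr_legged (S : {set T}) z q : (S \subset A :\ r) -> z \in S -> stable v' S -> stable u' S ->
  connected_on S z v' u' ->
  (forall y, y \in S -> (u' y == y) = (y == z)) ->
  #|porbit f' z| = q.*2.+1 ->
  (forall y, y \in S -> y \notin porbit f' z -> #|porbit f' y| = 4) ->
  legged S z q (restr_perm S v') (restr_perm S u').
Proof.
move=> SA zS vS uS conn fixS rootS faceS.
have ff : {in S, (restr_perm S u' * restr_perm S v')%g =1 f'}.
  by move=> y yS; rewrite [LHS]permM [RHS]permM (restrE uS) // (restrE vS) ?uS.
have ffs : stable (restr_perm S u' * restr_perm S v')%g S.
  by apply: stableM; apply: stable_on; exact: restr_perm_on.
have pff y : y \in S -> porbit (restr_perm S u' * restr_perm S v')%g y = porbit f' y.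
  by move=> yS; rewrite (porbit_eq_on ffs ff).
split=> //.
- exact: restr_perm_on.
- move=> y; case: (boolP (y \in S)) => yS; last by rewrite !(out_perm (restr_perm_on _ _)).
  by rewrite !(restrE uS) ?uS // rem_edge_inv.
- move=> y; case: (boolP (y \in S)) => yS; last first.
    by rewrite (out_perm (restr_perm_on _ _)) // eqxx !inE (negbTE yS) andbF.
  by rewrite (restrE uS) // fixS // !inE yS andbT negbK.
- move=> B zB vB uB; suff : S \subset B :&: S by rewrite subsetI => /andP[].
  apply: conn => [|y|y]; rewrite inE ?zB // => /andP[yB yS]; rewrite inE ?vS ?uS // andbT.
    by rewrite -(restrE vS) // vB.
  by rewrite -(restrE uS) // uB.
- by rewrite pff.
- by move=> y yS; rewrite !pff // => ?; apply: faceS.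
Qed.

(** Only [z] is unmatched in [S], so [#|S|] is odd; the faces other than that of [z] have degree 4
    and do not change parity. *)
Let odd_root (S : {set T}) z : (S \subset A :\ r) -> z \in S -> stable v' S -> stable u' S ->
  (forall y, y \in S -> (u' y == y) = (y == z)) ->
  (forall y, y \in S -> y \notin porbit f' z -> #|porbit f' y| = 4) ->
  odd #|porbit f' z|.
Proof.
move=> SA zS vS uS fixS faceS.
have fS : stable f' S := stableM uS vS.
have uR := restr_perm_on S u'.
have : 2 * #|porbit (restr_perm S u') @: S| = #|S| + #|[set z]|.
  apply: card_porbits_involution => [|y|y]; first by rewrite sub1set.
    case: (boolP (y \in S)) => yS; last by rewrite !(out_perm uR).
    by rewrite !(restrE uS) ?uS // rem_edge_inv.
  case: (boolP (y \in S)) => yS; last by rewrite (out_perm uR) // eqxx !inE (negbTE yS) andbF.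
  by rewrite (restrE uS) // fixS // !inE yS andbT negbK.
have := card_faces fS (@stable_porbit _ _ z) (porbit_stable fS zS) faceS.
rewrite cards1; clear; cardlia.
Qed.

(** The pieces are the component of [x] and its complement, which is connected from [s] by
    [rem_edge_conn]. The half-perimeters exist because both root faces are odd. *)
Lemma bridge_split : exists a b, [/\ (a + b).+1 = p, #|porbit f' x| = a.*2.+1,
    legged C x a (restr_perm C v') (restr_perm C u') /\ planar_leg C a (restr_perm C v') &
    legged D s b (restr_perm D v') (restr_perm D u') /\ planar_leg D b (restr_perm D v')].
Proof.
have DA : D \subset A :\ r by exact: subsetDl.
have inD y : (y \in D) = (y \notin C) && (y \in A :\ r) by rewrite inE.
have fC : stable f' C := stableM uC vC.
have fD : stable f' D := stableM uD vD.
have xD : x \notin D by rewrite inD xC.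
have fixC y : y \in C -> (u' y == y) = (y == x).
  move=> yC; have := subsetP CA _ yC; rewrite rem_edge_fix !inE => ->.
  have -> : y != s by apply: contraTneq yC => ->; exact: bridge_split_s.
  by rewrite andbT negbK.
have fixD y : y \in D -> (u' y == y) = (y == s).
  move=> yD; have := subsetP DA _ yD; rewrite rem_edge_fix !inE => ->.
  have -> : y != x by apply: contraTneq yD => ->.
  by rewrite !andbT negbK.
have faceC y : y \in C -> y \notin porbit f' x -> #|porbit f' y| = 4.
  move=> yC yx; apply: face' => //; first exact: (subsetP CA).
  by apply: contraL yC => /(subsetP (porbit_stable fD sD)); rewrite inD => /andP[].
have faceD y : y \in D -> y \notin porbit f' s -> #|porbit f' y| = 4.
  move=> yD ys; apply: face' => //; first exact: (subsetP DA).
  by apply: contraTN yD => /(subsetP (porbit_stable fC xC)); rewrite inD => ->.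
have oddC := odd_root CA xC vC uC fixC faceC.
have oddD := odd_root DA sD vD uD fixD faceD.
have connC : connected_on C x v' u' by move=> B; exact: component_sub.
have connD : connected_on D s v' u'.
  move=> B sB vB uB.
  have /subsetP sAB : A \subset r |: (C :|: B).
    by apply: rem_edge_conn; rewrite ?in_setU ?xC ?sB ?orbT //; exact: stableU.
  apply/subsetP => y; rewrite inD in_setD1 => /and3P[yC yr /sAB].
  by rewrite in_setU1 in_setU (negbTE yr) (negbTE yC).
exists #|porbit f' x|./2, #|porbit f' s|./2.
set a := _./2; set b := _./2.
have ea : #|porbit f' x| = a.*2.+1.
  by rewrite -[LHS]odd_double_half oddC.
have eb : #|porbit f' s| = b.*2.+1.
  by rewrite -[LHS]odd_double_half oddD.
have eab : (a + b).+1 = p by move: root_sum; rewrite ea eb; clear; lia.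
have MC := restr_legged CA xC vC uC connC fixC ea faceC.
have MD := restr_legged DA sD vD uD connD fixD eb faceD.
have vCr : {in C, porbit (restr_perm C v') =1 porbit v'}.
  apply: porbit_eq_on => // y yC; first by rewrite restrE.
have vDr : {in D, porbit (restr_perm D v') =1 porbit v'}.
  apply: porbit_eq_on => // y yD; first by rewrite restrE.
have gC := leg_genus MC; have gD := leg_genus MD.
have sumP := bridge_split_porbits.
have cAr : #|A| = (#|C| + #|D|).+1.
  by rewrite (cardsD1 r A) rA -(cardsID C (A :\ r)) (setIidPr CA).
move: Pl gC gD; rewrite /planar_leg (eq_in_imset vCr) (eq_in_imset vDr) sumP cAr => pl gC gD.
(* The two genus bounds sum to exactly the planarity equation of the whole map, so neither can be
   strict. *)
have [plC plD] : 4 * #|porbit v' @: C| = #|C| + 2 * a + 3 /\ 4 * #|porbit v' @: D| = #|D| + 2 * b + 3.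
  move: pl gC gD eab; clear; cardlia.
by split.
Qed.
End BridgeSplit.
End RemoveEdge.

(** * Root edges on a quadrangle *)

Section SplitFace.
Variables (T : finType) (x r s w : T) (f2 : {perm T}).
Hypotheses (fr : f2 r = r) (fs : f2 s = s).
Hypotheses (xNr : x != r) (sNr : s != r) (xNs : x != s).
Hypotheses (wNs : w != s) (wNx : w != x) (wx : w \in porbit f2 x).
(** Here [f1] inserts [s] after [w] on the face of [x], [g] inserts [r] after [x], and [f] cuts the
    result in two: [s] is followed by [f2 x] and preceded by [w], while [x] is followed by [r] and
    then by [f2 w]. *)
Let f1 := (tperm s w * f2)%g.
Let g := (tperm r x * f1)%g.
Let f := (tperm r s * g)%g.
Let U := r |: (s |: porbit f2 x).

Let not_fixed z y : f2 z = z -> y \in porbit f2 x -> x != z -> y != z.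
Proof.
move=> fz yx; apply: contraNneq => E; move: yx; rewrite E porbit_sym porbit_fix //.
by move/set1P->.
Qed.
Let wNr : w != r. Proof. exact: not_fixed. Qed.

Lemma split_face_s : f s = f2 x.
Proof. by rewrite !permM tpermR tpermL tpermD // eq_sym. Qed.
Lemma split_face_w : f w = s.
Proof.
rewrite !permM (@tpermD _ r s w) 1?eq_sym // (@tpermD _ r x w) 1?eq_sym //.
by rewrite tpermR fs.
Qed.
Lemma split_face_x : f x = r.
Proof.
rewrite !permM (@tpermD _ r s x) 1?eq_sym // tpermR.
by rewrite (@tpermD _ s w r) ?fr // eq_sym.
Qed.
Lemma split_face_other y : y != x -> y != r -> y != s -> y != w -> f y = f2 y.
Proof.
move=> yx yr ys yw; rewrite !permM (@tpermD _ r s y) 1?eq_sym //.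
by rewrite (@tpermD _ r x y) 1?eq_sym // (@tpermD _ s w y) 1?eq_sym.
Qed.

Lemma split_face_merged z : porbit f1 z =
  if z \in s |: porbit f2 x then s |: porbit f2 x else porbit f2 z.
Proof.
have ws : w \notin porbit f2 s by rewrite porbit_fix // inE.
rewrite (porbit_merge ws) (porbit_fix fs).
by have -> : porbit f2 w = porbit f2 x by apply/eqP; rewrite eq_porbit_mem.
Qed.

Let f1r : f1 r = r. Proof. by rewrite permM tpermD // eq_sym. Qed.

Let porbit_g z : porbit g z = if z \in U then U else porbit f2 z.
Proof.
have xr : x \notin porbit f1 r by rewrite porbit_fix // inE.
have e : porbit f1 x = s |: porbit f2 x.
  by rewrite split_face_merged in_setU1 porbit_id orbT.
rewrite (porbit_merge xr) (porbit_fix f1r) e -/U split_face_merged /U !in_setU1.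
by case: (z == r) => //=; case: (_ || _).
Qed.

Lemma split_face_sr : s \notin porbit f r.
Proof.
apply: porbits_split; last by rewrite eq_sym.
have rU : r \in U by rewrite in_setU1 eqxx.
by rewrite porbit_g rU !in_setU1 eqxx orbT.
Qed.

Let porbit_fx : porbit f x = porbit f r.
Proof. by apply/eqP; rewrite eq_sym eq_porbit_mem -split_face_x mem_porbitS porbit_id. Qed.

Let gE : g = (tperm r s * f)%g.
Proof. by rewrite /f mulgA tperm2 mul1g. Qed.

Lemma split_face_U : porbit f x :|: porbit f s = U.
Proof.
have := porbit_mergeL split_face_sr; rewrite -gE porbit_g !inE eqxx /= => ->.
by rewrite porbit_fx.
Qed.

Lemma split_face_sx : s \notin porbit f x.
Proof. by rewrite porbit_fx; exact: split_face_sr. Qed.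

Lemma split_face_out z : z \notin U -> porbit f z = porbit f2 z.
Proof.
move=> zU; have := porbit_merge split_face_sr z; rewrite -gE porbit_g (negbTE zU).
by rewrite -porbit_fx split_face_U (negbTE zU) => ->.
Qed.

Lemma card_split_face : #|porbit f x| + #|porbit f s| = #|porbit f2 x| + 2.
Proof.
have dis := porbit_disj split_face_sx.
have : #|porbit f x :|: porbit f s| = #|U| by rewrite split_face_U.
rewrite cardsU (disjoint_setI0 dis) cards0 subn0 => ->.
rewrite /U !cardsU1 !inE eq_sym (negbTE sNr) /=.
have nin z : f2 z = z -> x != z -> z \notin porbit f2 x.
  by move=> fz xz; apply/negP => /(not_fixed fz)/(_ xz); rewrite eqxx.
by rewrite !nin //=; cardlia.
Qed.

(** On the 4-cycle [s], [f2 x], [f2 (f2 x)], [w] the permutation [f] agrees with [f2] at the two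
    middle places. *)
Lemma split_face_quad : #|porbit f s| = 4 -> w = f2 (f2 (f2 x)).
Proof.
move=> c4; have := iter_porbit f s; have := uniq_traject_porbit f s; rewrite c4 /=.
rewrite split_face_s !inE !negb_or => /and4P[/and3P[n1 n2 n3] /andP[n4 n5] n6 _].
rewrite -[X in _ = X]split_face_w => /perm_inj E; rewrite E in n3 n5 n6.
have inS y : y \in porbit f s -> (y != x) && (y != r).
  move=> ys; apply/andP; split; apply: contraTneq ys => ->; rewrite porbit_sym.
    exact: split_face_sx.
  exact: split_face_sr.
have y1 : f2 x \in porbit f s by rewrite -split_face_s mem_porbitS porbit_id.
have y2 : f (f2 x) \in porbit f s by rewrite mem_porbitS.
have /andP[a1 a2] := inS _ y1; have /andP[b1 b2] := inS _ y2.
have e2 : f (f2 x) = f2 (f2 x) by apply: split_face_other; rewrite // eq_sym.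
by rewrite -e2 -E split_face_other // eq_sym.
Qed.

(** The length bound makes [x] and its next three images distinct, so the cut-off part is exactly
    [s] followed by those three images. *)
Lemma card_split_face4 : w = f2 (f2 (f2 x)) -> 4 < #|porbit f2 x| -> #|porbit f s| = 4.
Proof.
move=> wE; have := uniq_traject_porbit f2 x.
case: #|_| => [|[|[|[|n]]]] //= /and4P[]; rewrite !inE !negb_or -wE.
move=> /and4P[n1 n2 n3 _] /and3P[n4 n5 _] /andP[n6 _] _ _.
have y1 : f2 x \in porbit f2 x by rewrite mem_porbitS porbit_id.
have y2 : f2 (f2 x) \in porbit f2 x by rewrite mem_porbitS.
have e1 : f (f2 x) = f2 (f2 x).
  by apply: split_face_other; [rewrite eq_sym|exact: not_fixed|exact: not_fixed|].
have e2 : f (f2 (f2 x)) = w.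
  by rewrite [RHS]wE; apply: split_face_other; [rewrite eq_sym|exact: not_fixed|exact: not_fixed|].
have -> : porbit f s = [set:: [:: s; f2 x; f2 (f2 x); w]].
  apply/eqP; rewrite eqEsubset; apply/andP; split.
    apply: porbit_sub => [|z]; rewrite !inE ?eqxx // => /or4P[] /eqP->;
      by rewrite ?split_face_s ?e1 ?e2 ?split_face_w eqxx ?orbT.
  have i1 : f2 x \in porbit f s by rewrite -split_face_s mem_porbitS porbit_id.
  have i2 : f2 (f2 x) \in porbit f s by rewrite -e1 mem_porbitS.
  have i3 : w \in porbit f s by rewrite -e2 mem_porbitS.
  by apply/subsetP => z; rewrite !inE => /or4P[] /eqP-> //; exact: porbit_id.
rewrite cardsE; apply/card_uniqP => /=; rewrite !inE !negb_or n4 n5 n6 !(eq_sym s).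
by rewrite wNs (not_fixed fs y1 xNs) (not_fixed fs y2 xNs).
Qed.
End SplitFace.

(* The corner s of the new edge that closes a quadrangle with the root edge:  *)
(* it is inserted after the third step of the root face.                      *)
Definition third (T : finType) (x : T) (v u : {perm T}) : T :=
  let f := (u * v)%g in f (f (f x)).

Lemma tpermMl (T : finType) (a b : T) (t : {perm T}) : (tperm a b * t = t * tperm (t a) (t b))%g.
Proof. by rewrite conjgC tpermJ. Qed.

Section QuadGlue.
Variables (T : finType) (A : {set T}) (x r s : T) (p : nat) (v2 u : {perm T}).
Hypotheses (rA : r \in A) (sA : s \in A) (sNr : s != r) (p0 : 0 < p).
Hypotheses (M : legged (A :\ r :\ s) x p.+1 v2 u).
Let f2 := (u * v2)%g.
Let w := third x v2 u.
(** As [v' (u w) = s], the dart [s] comes right after [w] along the face. *)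
Let v' := (tperm s (u w) * v2)%g.
Let v := (tperm r x * v')%g.
Let u0 := (tperm r s * u)%g.
Let f' := (u * v')%g.
Let f := (u0 * v)%g.

Let von : perm_on (A :\ r :\ s) v2 := leg_on M.
Let uon : perm_on (A :\ r :\ s) u := leg_onu M.
Let v2r : v2 r = r. Proof. by rewrite (out_perm von) // !inE eqxx andbF. Qed.
Let v2s : v2 s = s. Proof. by rewrite (out_perm von) // !inE eqxx. Qed.
Let ur : u r = r. Proof. by rewrite (out_perm uon) // !inE eqxx andbF. Qed.
Let us : u s = s. Proof. by rewrite (out_perm uon) // !inE eqxx. Qed.
Let f2r : f2 r = r. Proof. by rewrite permM ur. Qed.
Let f2s : f2 s = s. Proof. by rewrite permM us. Qed.
Let x2 : [&& x != s, x != r & x \in A]. Proof. by have := leg_in M; rewrite !inE. Qed.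
Let xNs : x != s. Proof. by case/and3P: x2. Qed.
Let xNr : x != r. Proof. by case/and3P: x2. Qed.
Let xA : x \in A. Proof. by case/and3P: x2. Qed.
Let wx : w \in porbit f2 x. Proof. by rewrite !mem_porbitS porbit_id. Qed.
Let wA : w \in A :\ r :\ s. Proof. exact: (subsetP (leg_rootS M)). Qed.
Let uwA : u w \in A :\ r :\ s. Proof. by rewrite (perm_closed _ uon). Qed.
Let wNs : w != s. Proof. by move: wA; rewrite !inE => /andP[]. Qed.
Let uwNs : u w != s. Proof. by move: uwA; rewrite !inE => /andP[]. Qed.
Let uwNr : u w != r. Proof. by move: uwA; rewrite !inE => /and3P[]. Qed.
Let v'on : perm_on (A :\ r) v'.
Proof.
have [vo _] := perm_onU1 von; apply: perm_onM vo; apply: perm_on_tperm2.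
  by rewrite !inE sNr.
by move: uwA; rewrite inE => /andP[].
Qed.
Let v'r : v' r = r. Proof. by rewrite permM tpermD. Qed.

Let big_root : 4 < #|porbit f2 x|.
Proof. by rewrite (leg_root M); case: p p0. Qed.

Let wNx : w != x.
Proof.
rewrite eq_sym; have := uniq_traject_porbit f2 x; move: big_root.
by case: #|_| => [|[|[|[|n]]]] //= _ /andP[]; rewrite !inE !negb_or => /and4P[].
Qed.

Lemma quad_glue_vx : v x = r. Proof. exact: add_edge_vx. Qed.
Lemma quad_glue_ur : u0 r = s. Proof. exact: add_edge_ur. Qed.

Lemma quad_glue_f' : f' = (tperm s w * f2)%g.
Proof. by rewrite /f' /v' !mulgA; congr (_ * _)%g; rewrite [RHS]conjgC tpermJ us. Qed.

Let fE : f = (tperm r s * (tperm r x * (tperm s w * f2)))%g.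
Proof. by rewrite -quad_glue_f' /f /u0 /v /f' (add_edge_face _ _ ur (leg_ux M)). Qed.

Lemma quad_glue_sx : s \in porbit f' x.
Proof.
rewrite quad_glue_f' (split_face_merged f2s wNs wx) !in_setU1 porbit_id orbT in_setU1.
by rewrite eqxx.
Qed.

Lemma quad_glue_vertices : #|porbit v @: A| = #|porbit v2 @: (A :\ r :\ s)|.
Proof.
rewrite (card_vertices_insert rA xA xNr v'on) /v' card_vertices_insert //.
  by rewrite !inE sNr.
by move: uwA; rewrite inE => /andP[].
Qed.

Let c4 : #|porbit f s| = 4.
Proof. by rewrite fE; exact: card_split_face4. Qed.

(** The two new darts add 2 to the old root face and the new quadrangle takes 4:
    [(2p+3) + 2 - 4 = 2p+1]. *)
Lemma quad_glue_legged : legged A x p v u0.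
Proof.
have [vA _] := perm_onU1 v'on.
split=> //.
- exact: perm_onM (perm_on_tperm2 rA xA) vA.
- apply: add_edge_inv => //; exact: leg_inv M.
- apply: add_edge_fix => // y; rewrite (leg_fix M) !inE.
  by case: (y == x); rewrite /= ?andbF.
- move=> B xB vB uB.
  have rB : r \in B by rewrite -(add_edge_vx x v'r); exact: vB.
  have sB : s \in B by rewrite -(add_edge_ur r us); exact: uB.
  have vB' : stable v' B.
    rewrite -[v']mul1g -(tperm2 r x) -mulgA.
    by apply: stableM => //; exact: stable_tperm.
  have uB' : stable u B.
    rewrite -[u]mul1g -(tperm2 r s) -mulgA.
    by apply: stableM => //; exact: stable_tperm.
  have uwB : u w \in B by rewrite -(stable_iff vB') permM tpermR v2s.
  have v2B : stable v2 B.
    rewrite -[v2]mul1g -(tperm2 s (u w)) -mulgA.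
    by apply: stableM => //; exact: stable_tperm.
  apply/subsetP => y yA; have [->//|yr] := eqVneq y r; have [->//|ys] := eqVneq y s.
  by apply: (subsetP (leg_conn M xB v2B uB')); rewrite !inE yr ys.
- have := card_split_face f2r f2s xNr sNr xNs wNs wNx wx; rewrite -fE c4 (leg_root M).
  rewrite -/f; clear; lia.
- move=> y yA yx; case: (boolP (y \in porbit f s)) => ys.
    by move: ys; rewrite -eq_porbit_mem => /eqP->.
  have U := split_face_U f2r f2s xNr sNr xNs wNs wx; rewrite -fE in U.
  have yU : y \notin r |: (s |: porbit f2 x).
    by rewrite -U in_setU negb_or ys yx.
  rewrite -/f fE split_face_out //.
  move: yU; rewrite !in_setU1 !negb_or => /and3P[yr y_s yx'].
  by apply: (leg_face M) => //; rewrite !inE yr y_s.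
Qed.

Lemma quad_glue_planar : planar_leg (A :\ r :\ s) p.+1 v2 -> planar_leg A p v.
Proof.
rewrite /planar_leg quad_glue_vertices => ->.
have := cardsD1 r A; have := cardsD1 s (A :\ r); rewrite rA !inE sNr sA /=; clear; cardlia.
Qed.
End QuadGlue.

Section QuadSplit.
Variables (T : finType) (A : {set T}) (x r s : T) (p : nat) (v u : {perm T}).
Hypotheses (M : legged A x p v u) (vx : v x = r) (urs : u r = s) (xNr : x != r).
Let v' := (tperm r x * v)%g.
Let u' := (tperm r s * u)%g.
Let f' := (u' * v')%g.
Let f := (u * v)%g.
Hypotheses (Pl : planar_leg A p v) (sx : s \in porbit f' x).
(** The predecessor of [s] at its vertex; transposing it with [s] detaches [s], and [w] is the dart
    before [s] on its face. *)
Let b := (v'^-1)%g s.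
Let v2 := (tperm s b * v')%g.
Let f2 := (u' * v2)%g.
Let w := u' b.

Let rA := rem_edge_rA M vx.
Let xA := leg_in M.
Let sA := rem_edge_sA M vx urs.
Let sNr := rem_edge_sNr M vx urs xNr.
Let xNs := rem_edge_xNs M urs xNr.
Let v'r : v' r = r := rem_edge_vr vx.
Let u'r : u' r = r := rem_edge_ur M urs.
Let u's : u' s = s := rem_edge_us urs.
Let u'x : u' x = x := rem_edge_ux M urs xNr.
Let von := rem_edge_von M vx.
Let uon := rem_edge_uon M vx urs.
Let u'inv := rem_edge_inv M urs.
Let vb : v' b = s. Proof. by rewrite permKV. Qed.
Let bNs : b != s.
Proof.
apply: contraNneq xNs => E; move: sx; rewrite porbit_sym porbit_fix ?inE //.
by rewrite permM u's -{1}E vb.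
Qed.
Let v2s : v2 s = s. Proof. by rewrite permM tpermL vb. Qed.
Let uw : u' w = b. Proof. exact: u'inv. Qed.
Let wNs : w != s. Proof. by rewrite -[s]u's (inj_eq perm_inj). Qed.
Let v'E : v' = (tperm s (u' w) * v2)%g.
Proof. by rewrite uw mulgA tperm2 mul1g. Qed.
Let f2s : f2 s = s. Proof. by rewrite permM u's. Qed.
Let f'E : f' = (tperm s w * f2)%g.
Proof.
have e : (u' * tperm s (u' w))%g = (tperm s w * u')%g by rewrite tpermMl u's.
by rewrite /f' v'E [LHS]mulgA e -mulgA.
Qed.
Let sAr : s \in A :\ r. Proof. by rewrite !inE sNr. Qed.
Let bAr : b \in A :\ r. Proof. by rewrite -(perm_closed _ von) vb. Qed.
Let bNr : b != r. Proof. by move: bAr; rewrite !inE => /andP[]. Qed.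
Let wNr : w != r. Proof. by rewrite -[r]u'r (inj_eq perm_inj). Qed.
Let f2r : f2 r = r. Proof. by rewrite permM u'r permM tpermD // eq_sym. Qed.
Let wx : w \in porbit f2 x.
Proof.
have ws : w \notin porbit f2 s by rewrite porbit_fix // inE.
have e := porbit_merge ws; rewrite -f'E (porbit_fix f2s) in e.
move: sx; rewrite porbit_sym e in_setU set11 /= in_setU in_set1 (negbTE xNs) /=.
by rewrite porbit_sym.
Qed.
Let fE0 : f = (tperm r s * (tperm r x * f'))%g.
Proof.
rewrite -(add_edge_face _ _ u'r u'x); rewrite /f {1}(rem_edge_u r s u).
by rewrite {1}(rem_edge_v x r v).
Qed.
Let fE : f = (tperm r s * (tperm r x * (tperm s w * f2)))%g.
Proof. by rewrite -f'E. Qed.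

Let wNx : w != x.
Proof.
(* If [w] were [x], the far side of the root edge would be a face of degree 1 instead of 4. *)
apply/eqP => E.
have f'x : f' x = s by rewrite f'E permM -E tpermR f2s.
have fs : f s = s by rewrite fE0 permM tpermR permM tpermL f'x.
have fx : f x = r.
  rewrite fE0 permM tpermD 1?eq_sym // permM tpermR f'E permM tpermD // eq_sym //.
have : s \notin porbit f x by rewrite porbit_sym porbit_fix // inE.
by move/(leg_face M sA); rewrite porbit_fix // cards1.
Qed.

Let s_out : s \notin porbit f x. Proof. by rewrite fE; exact: split_face_sx. Qed.
Let c4 : #|porbit f s| = 4. Proof. exact: (leg_face M sA). Qed.

(** The place where [s] was attached is forced by the degree 4 of its face, so the reduced map
    determines the original one. *)
Lemma quad_split_third : w = third x v2 u'.
Proof. by apply: (split_face_quad f2r f2s xNr sNr xNs wNs wNx wx); rewrite -fE. Qed.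

Lemma quad_split_v : v = (tperm r x * (tperm s (u' (third x v2 u')) * v2))%g.
Proof. by rewrite -quad_split_third -v'E -rem_edge_v. Qed.

Lemma quad_split_legged : legged (A :\ r :\ s) x p.+1 v2 u'.
Proof.
split.
- by rewrite !inE xNs xNr.
- apply: perm_onD1 v2s; apply: perm_onM von; exact: perm_on_tperm2.
- exact: u'inv.
- move=> y; rewrite (rem_edge_fix M urs) !inE.
  by case: (y == x); rewrite /= ?andbF.
- move=> B xB vB uB.
  have fB : stable f2 B := stableM uB vB.
  have wB : w \in B by rewrite quad_split_third /third !fB.
  have bB : b \in B by rewrite -uw uB.
  have s1 : s \in s |: B by rewrite setU11.
  have b1 : b \in s |: B by rewrite in_setU1 bB orbT.
  have : A \subset r |: (s |: B).
    apply: (rem_edge_conn M vx urs) => //; first by rewrite in_setU1 xB orbT.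
      rewrite -/v' v'E uw; apply: stableM; first exact: stable_tperm.
      by move=> y; rewrite !in_setU1 => /orP[/eqP->|/vB->]; rewrite ?v2s ?eqxx ?orbT.
    by move=> y; rewrite !in_setU1 => /orP[/eqP->|/uB->]; rewrite ?u's ?eqxx ?orbT.
  move/subsetP => AB; apply/subsetP => y; rewrite !inE => /and3P[y_s y_r /AB].
  by rewrite !in_setU1 (negbTE y_s) (negbTE y_r).
- have := card_split_face f2r f2s xNr sNr xNs wNs wNx wx; rewrite -fE c4.
  rewrite -/f2 (leg_root M); clear; cardlia.
- move=> y; rewrite !inE => /and3P[y_s y_r yA] yx.
  have yU : y \notin r |: (s |: porbit f2 x).
    by rewrite !in_setU1 (negbTE y_s) (negbTE y_r).
  have := split_face_out f2r f2s xNr sNr xNs wNs wx yU; rewrite -fE => <-.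
  apply: (leg_face M) => //; apply: contra yU.
  have := split_face_U f2r f2s xNr sNr xNs wNs wx; rewrite -fE => <-.
  by rewrite in_setU => ->.
Qed.

Lemma quad_split_planar : planar_leg (A :\ r :\ s) p.+1 v2.
Proof.
have e : #|porbit v @: A| = #|porbit v2 @: (A :\ r :\ s)|.
  rewrite (rem_edge_vertices M vx xNr) -/v' v'E uw card_vertices_insert //.
  apply: perm_onD1 v2s; apply: perm_onM von; exact: perm_on_tperm2.
move: Pl; rewrite /planar_leg e => ->.
have := cardsD1 r A; have := cardsD1 s (A :\ r); rewrite rA sAr /=; clear; cardlia.
Qed.
End QuadSplit.

(** * Counting labelled maps *)

Section RootEdge.
Variables (T : finType) (A : {set T}) (x r s : T) (p : nat).
Implicit Types m : {perm T} * {perm T}.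
Hypotheses (rA : r \in A) (sA : s \in A) (xA : x \in A).
Hypotheses (xNr : x != r) (sNr : s != r) (xNs : x != s).

Definition cut_v m := (tperm r x * m.1)%g.
Definition cut_u m := (tperm r s * m.2)%g.
Definition root_edge_maps := [set m in leg_maps A x p.+1 | (m.1 x == r) && (m.2 r == s)].
Definition root_edge_bridge m := s \notin porbit (cut_u m * cut_v m)%g x.

Lemma tpermKl a b : cancel (mulg (tperm a b : {perm T})) (mulg (tperm a b)).
Proof. by move=> t; rewrite mulgA tperm2 mul1g. Qed.

(** The map [G] inserts the root edge so as to cut off a quadrangle; [QuadSplit] shows that it is
    onto. *)
Lemma card_root_edge_quad :
  #|[set m in root_edge_maps | ~~ root_edge_bridge m]| = #|leg_maps (A :\ r :\ s) x p.+2|.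
Proof.
pose G m := ((tperm r x * (tperm s (m.2 (third x m.1 m.2)) * m.1))%g, (tperm r s * m.2)%g).
rewrite -[RHS](card_in_imset (f := G)).
  apply: eq_card => m; apply/idP/imsetP => [|[m2 /leg_mapsP[M P] ->]].
    rewrite /root_edge_bridge inE negbK => /andP[]; rewrite inE => /andP[/leg_mapsP[M P]].
    case/andP=> /eqP vx /eqP ur sx; exists ((tperm s (((cut_v m)^-1)%g s) * cut_v m)%g, cut_u m).
      apply/leg_mapsP; split; first exact: (quad_split_legged M vx ur xNr sx).
      exact: (quad_split_planar M vx ur xNr P sx).
    rewrite /G /= -(quad_split_v M vx ur xNr sx) /cut_u tpermKl.
    by case: (m).
  have M1 := quad_glue_legged rA sA sNr (ltn0Sn p) M.
  rewrite /root_edge_bridge inE negbK inE /G /= (quad_glue_vx sNr M) (quad_glue_ur M).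
  rewrite !eqxx /= andbT /cut_v /cut_u /= !tpermKl.
  apply/andP; split; last exact: (quad_glue_sx M).
  by apply/leg_mapsP; split=> //=; exact: (quad_glue_planar rA sA sNr M P).
move=> m1 m2 /leg_mapsP[M1 P1] /leg_mapsP[M2 P2] [/(can_inj (@tpermKl r x)) ev].
move=> /(can_inj (@tpermKl r s)) eu.
have fix_s m : legged (A :\ r :\ s) x p.+2 m.1 m.2 -> m.1 s = s.
  by move=> M; rewrite (out_perm (leg_on M)) // !inE eqxx.
move: ev; set b1 := m1.2 _; set b2 := m2.2 _ => ev.
(* Both are the predecessor of [s] in the same vertex permutation. *)
have eb : b1 = b2.
  apply: (@perm_inj _ (tperm s b1 * m1.1)%g); rewrite {2}ev !permM !tpermR.
  by rewrite !fix_s.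
by move: ev; rewrite eb => /mulgI; case: (m1) (m2) eu => [v1 u1] [v2 u2] /= -> ->.
Qed.

Lemma glue_inj (A1 A2 : {set T}) (s1 s2 t1 t2 : {perm T}) : [disjoint A1 & A2] ->
  perm_on A1 s1 -> perm_on A2 s2 -> perm_on A1 t1 -> perm_on A2 t2 ->
  (s1 * s2 = t1 * t2)%g -> s1 = t1 /\ s2 = t2.
Proof.
move=> dis s1A s2A t1A t2A E.
have e1 : s1 = t1.
  apply/permP => y; case: (boolP (y \in A1)) => yA; last by rewrite !(out_perm _ yA).
  by rewrite (glueL dis s1A s2A yA) E (glueL dis t1A t2A yA).
by move: E; rewrite e1 => /mulgI->.
Qed.

Section Component.
Variables (A1 : {set T}) (a : nat).
Hypotheses (A1A : A1 \subset A :\ r :\ s) (ap : a < p.+1).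
Let A2 := A :\ r :\: A1.

(** Gluing is a bijection from pairs of maps on the two dart sets; its inverse deletes the edge and
    restricts both permutations to [A1] and [A2]. *)
Lemma card_root_edge_component :
  #|[set m in root_edge_maps | root_edge_bridge m & (component (cut_v m) (cut_u m) x == A1)
       && (#|porbit (cut_u m * cut_v m)%g x| == a.*2.+1)]| =
  #|leg_maps A1 x a| * #|leg_maps A2 s (p - a)|.
Proof.
have A1r : A1 \subset A :\ r by apply: subset_trans A1A (subD1set _ _).
have defA : A1 :|: A2 = A :\ r by rewrite -{1}(setIidPr A1r) setID.
have dis : [disjoint A1 & A2] by rewrite disjoint_sym disjoints_subset /A2 setDE subsetIr.
pose G (mm : ({perm T} * {perm T}) * ({perm T} * {perm T})) :=
  ((tperm r x * (mm.1.1 * mm.2.1))%g, (tperm r s * (mm.1.2 * mm.2.2))%g).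
rewrite -cardsX -[RHS](card_in_imset (f := G)).
  apply: eq_card => m; apply/idP/imsetP => [|[[m1 m2]]].
    rewrite inE => /and3P[]; rewrite inE => /andP[/leg_mapsP[M P] /andP[/eqP vx /eqP ur]].
    move=> sx /andP[/eqP cE /eqP rE].
    have [a' [b [ab rE' [MC PC] [MD PD]]]] := bridge_split M vx ur xNr P sx.
    have ea : a' = a by move: rE'; rewrite rE => -[/double_inj].
    have eb : b = p - a by rewrite -ea; case: ab => <-; rewrite addKn.
    move: MC PC MD PD; rewrite -/(cut_v m) -/(cut_u m) cE -/A2 ea eb => MC PC MD PD.
    exists ((restr_perm A1 (cut_v m), restr_perm A1 (cut_u m)),
            (restr_perm A2 (cut_v m), restr_perm A2 (cut_u m))).
      by rewrite inE; apply/andP; split; apply/leg_mapsP.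
    have glue w : perm_on (A :\ r) w -> stable w A1 -> (restr_perm A1 w * restr_perm A2 w)%g = w.
      move=> wA w1; have w2 : stable w A2 by exact: stableD (stable_on wA) w1.
      have r1 := restr_perm_on A1 w; have r2 := restr_perm_on A2 w.
      apply/permP => y; case: (boolP (y \in A1)) => y1.
        by rewrite -(glueL dis r1 r2 y1) (restrE w1).
      case: (boolP (y \in A2)) => y2; first by rewrite -(glueR dis r1 y2) (restrE w2).
      rewrite permM (out_perm r1 y1) (out_perm r2 y2) (out_perm wA) //.
      by rewrite -defA inE negb_or y1.
    have s1 : stable (cut_v m) A1 by rewrite -cE; exact: component_stablev.
    have s2 : stable (cut_u m) A1 by rewrite -cE; exact: component_stableu.
    rewrite /G /= (glue _ (rem_edge_von M vx) s1) (glue _ (rem_edge_uon M vx ur) s2).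
    by rewrite /cut_v /cut_u !tpermKl; case: (m).
  move=> /setXP[/leg_mapsP[M1 P1] /leg_mapsP[M2 P2]] ->; rewrite /= in M1 P1 M2 P2.
  have M := bridge_glue_legged rA defA dis M1 M2.
  rewrite subnKC // in M.
  rewrite inE inE /root_edge_bridge /G /cut_v /cut_u /= !tpermKl.
  rewrite (bridge_glue_vx defA M1 M2) (bridge_glue_ur r dis M1 M2) !eqxx !andbT.
  rewrite (bridge_glue_sx dis M1 M2) (bridge_glue_component dis M1 M2) eqxx (bridge_glue_root dis M1 M2).
  rewrite (leg_root M1) eqxx /=.
  rewrite andbT; apply/leg_mapsP; split=> //=.
  move: P1 P2; rewrite /planar_leg (bridge_glue_vertices rA defA dis M1 M2).
  have := cardsD1 r A; rewrite -defA cardsU (disjoint_setI0 dis) cards0 subn0 rA.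
  move: ap; clear; cardlia.
move=> [m1 m2] [n1 n2] /setXP[/leg_mapsP[M1 _] /leg_mapsP[M2 _]].
move=> /setXP[/leg_mapsP[N1 _] /leg_mapsP[N2 _]] [/(can_inj (@tpermKl r x)) ev].
move=> /(can_inj (@tpermKl r s)) eu.
have [e1 e2] := glue_inj dis (leg_on M1) (leg_on M2) (leg_on N1) (leg_on N2) ev.
have [e3 e4] := glue_inj dis (leg_onu M1) (leg_onu M2) (leg_onu N1) (leg_onu N2) eu.
by case: (m1) (m2) (n1) (n2) e1 e2 e3 e4 => [? ?] [? ?] [? ?] [? ?] /= -> -> -> ->.
Qed.
End Component.

Lemma card_root_edge_bridge :
  #|[set m in root_edge_maps | root_edge_bridge m]| =
  \sum_(A1 : {set T} | (x \in A1) && (A1 \subset A :\ r :\ s))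
     \sum_(a < p.+1) #|leg_maps A1 x a| * #|leg_maps (A :\ r :\: A1) s (p - a)|.
Proof.
set S := [set m in _ | _].
have inS m : m \in S -> exists a : nat, [/\ a < p.+1,
    #|porbit (cut_u m * cut_v m)%g x| = a.*2.+1 & s \notin component (cut_v m) (cut_u m) x].
  rewrite inE => /andP[]; rewrite inE => /andP[/leg_mapsP[M P] /andP[/eqP vx /eqP ur]] sx.
  have [a [b [[ab] rE _ _]]] := bridge_split M vx ur xNr P sx.
  exists a; split=> //; first by rewrite -ab ltnS leq_addr.
  exact: bridge_split_s M vx ur xNr P sx.
rewrite -sum1_card (partition_big (fun m => component (cut_v m) (cut_u m) x)
  (fun A1 => (x \in A1) && (A1 \subset A :\ r :\ s))) /=; last first.
  move=> m mS; have [_ [_ _ sC]] := inS m mS.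
  rewrite component_id subsetD1 sC andbT.
  move: mS; rewrite inE => /andP[]; rewrite inE => /andP[/leg_mapsP[M P] /andP[/eqP vx /eqP ur]] _.
  apply: component_sub; first by rewrite !inE xNr.
    exact: (rem_edge_vAr M vx).
  exact: (rem_edge_uAr M vx ur).
apply: eq_bigr => A1 /andP[xA1 A1A].
rewrite (partition_big (fun m => inord (#|porbit (cut_u m * cut_v m)%g x|./2) : 'I_p.+1) predT) //=.
apply: eq_bigr => a _; rewrite -(card_root_edge_component A1A (ltn_ord a)) sum1dep_card.
apply: eq_card => m; rewrite [LHS]inE [RHS]inE.
set c := component _ _ _ == _; set d := #|_| == _.
have -> : [&& m \in root_edge_maps, root_edge_bridge m, c & d] = (m \in S) && (c && d).
  by rewrite [m \in S]inE -andbA.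
case: (boolP (m \in S)) => //= mS; have [a' [ap rE _]] := inS m mS.
rewrite /d rE /= uphalf_double -val_eqE /= inordK // eqSS.
by congr (_ && _); apply/eqP/eqP => [->|/double_inj].
Qed.
End RootEdge.

(** Maps are sorted by the darts [r = v x] and [s = u r] of the root edge, then by whether it is a
    bridge. A root face of length above 1 ensures [r != x]. *)
Lemma card_leg_maps_rec (T : finType) (A : {set T}) (x : T) (p : nat) : x \in A ->
  #|leg_maps A x p.+1| = \sum_(r in A :\ x) \sum_(s in A :\ x :\ r)
    (#|leg_maps (A :\ r :\ s) x p.+2| +
     \sum_(A1 : {set T} | (x \in A1) && (A1 \subset A :\ r :\ s))
       \sum_(a < p.+1) #|leg_maps A1 x a| * #|leg_maps (A :\ r :\: A1) s (p - a)|).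
Proof.
move=> xA.
have vx m : m \in leg_maps A x p.+1 -> x != m.1 x.
  move=> /leg_mapsP[M _]; apply/eqP => E; have := leg_root M.
  by rewrite porbit_fix ?cards1 // permM (leg_ux M) -E.
rewrite -[LHS]sum1_card (partition_big (fun m : {perm T} * {perm T} => m.1 x) (mem (A :\ x))) /=; last first.
  move=> m mS; have /leg_mapsP[M _] := mS.
  by rewrite !inE eq_sym vx // (perm_closed _ (leg_on M)).
apply: eq_bigr => r; rewrite !inE => /andP[rNx rA]; have xNr : x != r by rewrite eq_sym.
rewrite (partition_big (fun m : {perm T} * {perm T} => m.2 r) (mem (A :\ x :\ r))) /=; last first.
  move=> m /andP[/leg_mapsP[M _] /eqP vr].
  rewrite !inE (rem_edge_sNr M vr erefl xNr) (rem_edge_sA M vr erefl) andbT.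
  by rewrite eq_sym (rem_edge_xNs M erefl xNr).
apply: eq_bigr => s; rewrite !inE => /and3P[sNr sNx sA].
rewrite -(card_root_edge_quad p rA sA xNr sNr) -(card_root_edge_bridge s p rA xA xNr).
rewrite sum1dep_card addnC -(cardsID [set m | root_edge_bridge x r s m]).
by congr (_ + _); apply: eq_card => m; rewrite !inE -!andbA // andbC -!andbA.
Qed.

(** A root face of length 1 makes the leg a fixed point of [u] and [v], so connectedness leaves
    nothing but [x]. *)
Lemma leg_maps0 (T : finType) (A : {set T}) (x : T) :
  #|leg_maps A x 0| = (A == [set x]).
Proof.
case: eqP => [->|nA].
  apply/eqP/cards1P; exists (1, 1)%g; apply/setP => -[v u]; rewrite in_set1.
  have on1 w : perm_on [set x] w -> w = 1%g by move=> wx; apply: perm_on_id wx _; rewrite cards1.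
  apply/leg_mapsP/eqP => /= [[M _]|[-> ->]].
    by rewrite (on1 _ (leg_on M)) (on1 _ (leg_onu M)).
  have p1 y : porbit (1 * 1)%g y = [set y] by rewrite porbit_fix // mulg1 perm1.
  split; last by rewrite /planar_leg imset_set1 !cards1.
  split=> [||y|y|B xB _ _||y].
  - exact: set11.
  - exact: perm_on1.
  - by rewrite !perm1.
  - by rewrite perm1 eqxx !inE; case: (y == x).
  - by rewrite sub1set.
  - by rewrite p1 cards1.
  - by rewrite p1 => ->.
apply/eqP; rewrite cards_eq0; apply/eqP/setP => m; rewrite in_set0; apply/leg_mapsP => -[M _].
apply: nA; apply/eqP; rewrite eqEsubset sub1set (leg_in M) andbT.
have fx : (m.2 * m.1)%g x = x.
  have /cards1P[y E] : #|porbit (m.2 * m.1)%g x| == 1 by rewrite (leg_root M).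
  have h z : z \in porbit (m.2 * m.1)%g x -> z = y by rewrite E => /set1P.
  by rewrite (h ((m.2 * m.1)%g x)) ?mem_porbitS ?porbit_id // -(h x) ?porbit_id.
apply: (leg_conn M) => [|y|y]; rewrite !in_set1 // => /eqP->; last by rewrite (leg_ux M).
by move: fx; rewrite permM (leg_ux M) => ->.
Qed.

(** * Transport of permutations along an injection *)

Section ExtendPerm.
Variables (S T : finType) (i : S -> T).
Hypothesis i_inj : injective i.
Implicit Types s t : {perm S}.
Local Notation B := (i @: [set: S]).

Definition ext_fun s (y : T) : T := if [pick d | i d == y] is Some d then i (s d) else y.

Lemma ext_funE s d : ext_fun s (i d) = i (s d).
Proof.
rewrite /ext_fun; case: pickP => [d' /eqP/i_inj-> //|/(_ d)]; by rewrite eqxx.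
Qed.

Lemma ext_fun_out s y : y \notin B -> ext_fun s y = y.
Proof.
by rewrite /ext_fun; case: pickP => // d /eqP<-; rewrite imset_f ?inE.
Qed.

Lemma ext_fun_inj s : injective (ext_fun s).
Proof.
move=> y z; case: (boolP (y \in B)) => [/imsetP[d _ ->]|yB];
  case: (boolP (z \in B)) => [/imsetP[d' _ ->]|zB];
  rewrite ?ext_funE ?(ext_fun_out _ yB) ?(ext_fun_out _ zB) //.
- by move/i_inj/perm_inj->.
- by move=> E; move: zB; rewrite -E imset_f ?inE.
- by move=> E; move: yB; rewrite E imset_f ?inE.
Qed.

Definition ext_perm s : {perm T} := perm (@ext_fun_inj s).

Lemma ext_permE s d : ext_perm s (i d) = i (s d).
Proof. by rewrite permE ext_funE. Qed.

Lemma ext_perm_on s : perm_on B (ext_perm s).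
Proof.
apply/subsetP => y; rewrite inE /= permE; apply: contraNT => yB; by rewrite ext_fun_out.
Qed.

Lemma ext_permM s t : ext_perm (s * t) = (ext_perm s * ext_perm t)%g.
Proof.
apply/permP => y; rewrite permM; case: (boolP (y \in B)) => [/imsetP[d _ ->]|yB].
  by rewrite !ext_permE permM.
by rewrite !(out_perm (ext_perm_on _) yB).
Qed.

Lemma ext_perm_inj : injective ext_perm.
Proof. by move=> s t E; apply/permP => d; apply: i_inj; rewrite -!ext_permE E. Qed.

Lemma ext_perm_onto w : perm_on B w -> exists s, ext_perm s = w.
Proof.
move=> wB; pose g d := odflt d [pick d' | i d' == w (i d)].
have gE d : i (g d) = w (i d).
  have : w (i d) \in B by rewrite (perm_closed _ wB) imset_f ?inE.
  by rewrite /g; case: pickP => [d' /eqP//|no /imsetP[d' _ E]]; have := no d'; rewrite E eqxx.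
have g_inj : injective g by move=> d d' E; apply/i_inj/(@perm_inj _ w); rewrite -!gE E.
exists (perm g_inj); apply/permP => y.
case: (boolP (y \in B)) => [/imsetP[d _ ->]|yB]; first by rewrite ext_permE permE gE.
by rewrite (out_perm (ext_perm_on _)) // (out_perm wB).
Qed.

Lemma porbit_ext s d : porbit (ext_perm s) (i d) = i @: porbit s d.
Proof.
apply/setP => y; apply/porbitP/imsetP => [[k ->]|[d' /porbitP[k ->] ->]].
  exists ((s ^+ k)%g d); first exact: mem_porbit.
  by elim: k => [|k IH]; rewrite ?perm1 // !expgSr !permM IH ext_permE.
by exists k; elim: k => [|k IH]; rewrite ?perm1 // !expgSr !permM -IH ext_permE.
Qed.

Lemma card_porbits_ext s : #|porbit (ext_perm s) @: B| = #|porbits s|.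
Proof.
rewrite -(card_imset _ (imset_inj i_inj)); apply: eq_card => F.
apply/imsetP/imsetP => [[_ /imsetP[d _ ->] ->]|[_ /imsetP[d _ ->] ->]].
  by exists (porbit s d); rewrite ?porbit_ext // imset_f.
by exists (i d); rewrite ?porbit_ext // imset_f ?inE.
Qed.
End ExtendPerm.

(** The final transposition inserts [x] just before the root dart in the cycle of its vertex, hence
    also on the root face. *)
Definition leg_of_rooted (e : nat) (T : finType) (i : dart e -> T) (i_inj : injective i)
    (x : T) (M : rmap e) : {perm T} * {perm T} :=
  ((ext_perm i_inj (vperm M) * tperm x (i (Defs.root M)))%g, ext_perm i_inj (eperm M)).

Section LegOfRooted.
Variables (e n p : nat) (T : finType) (A : {set T}) (x : T) (i : dart e -> T).
Hypotheses (i_inj : injective i) (xA : x \in A) (iA : i @: [set: dart e] = A :\ x).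
Hypotheses (np : e + p + 2 = n.*2).
Local Notation legof := (leg_of_rooted i_inj x).

Let cA : #|A| = e.*2.+1.
Proof. by rewrite (cardsD1 x) xA -iA card_imset // cardsT card_ord. Qed.

Let iAx d : i d \in A :\ x. Proof. by rewrite -iA imset_f ?inE. Qed.
Let iNx d : i d != x. Proof. by have := iAx d; rewrite !inE => /andP[]. Qed.

Section OneMap.
Variable M : rmap e.
Let v0 := vperm M.
Let u0 := eperm M.
Let r0 := Defs.root M.
Let v' := ext_perm i_inj v0.
Let u := ext_perm i_inj u0.
Let R := i r0.
Let v := (v' * tperm x R)%g.
Let f' := (u * v')%g.
Let k := ((v'^-1)%g R).

Let v'on : perm_on (A :\ x) v'. Proof. by rewrite -iA; exact: ext_perm_on. Qed.
Let uon : perm_on (A :\ x) u. Proof. by rewrite -iA; exact: ext_perm_on. Qed.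
Let v'x : v' x = x. Proof. by rewrite (out_perm v'on) // !inE eqxx. Qed.
Let ux : u x = x. Proof. by rewrite (out_perm uon) // !inE eqxx. Qed.
Let vk : v' k = R. Proof. by rewrite permKV. Qed.
Let vE : v = (tperm x k * v')%g. Proof. by rewrite tpermMl v'x vk. Qed.
Let kAx : k \in A :\ x. Proof. by rewrite -(perm_closed _ v'on) vk iAx. Qed.
Let kNx : k != x. Proof. by move: kAx; rewrite !inE => /andP[]. Qed.
Let kA : k \in A. Proof. by move: kAx; rewrite !inE => /andP[]. Qed.
Let f'E : f' = ext_perm i_inj (fperm M). Proof. by rewrite /f' /fperm ext_permM. Qed.
Let f'x : f' x = x. Proof. by rewrite permM ux. Qed.

Let porbit_f z : porbit (u * v)%g z =
  if z \in x |: i @: porbit (fperm M) r0 then x |: i @: porbit (fperm M) r0 else porbit f' z.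
Proof.
pose k' := (u^-1)%g k.
have uk' : u k' = k by rewrite permKV.
have -> : (u * v)%g = (tperm x k' * f')%g.
  by rewrite vE /f' [RHS]mulgA [in RHS]tpermMl ux uk' -mulgA.
have xk' : k' \notin porbit f' x.
  by rewrite porbit_fix // inE; apply: contraNneq kNx => E; rewrite -uk' E ux.
have E : porbit f' k' = i @: porbit (fperm M) r0.
  have fk : f' k' = R by rewrite permM uk' vk.
  have /eqP-> : porbit f' k' == porbit f' R.
    by rewrite eq_sym eq_porbit_mem -fk mem_porbitS porbit_id.
  by rewrite f'E porbit_ext.
by rewrite (porbit_merge xk') (porbit_fix f'x) E.
Qed.

Let r_vertices : #|porbit v @: A| = #|vertices M|.
Proof.
rewrite vE (@card_vertices_insert _ A k x) // -iA; exact: card_porbits_ext.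
Qed.


Let vx : v x = R. Proof. by rewrite permM v'x tpermL. Qed.
Let v'E : v' = (v * tperm x R)%g. Proof. by rewrite -mulgA tperm2 mulg1. Qed.

Let stable_ext C : stable v0 C -> stable u0 C -> r0 \in C ->
  stable v (x |: i @: C) /\ stable u (x |: i @: C).
Proof.
move=> vC uC rC; have RB : R \in x |: i @: C by rewrite in_setU1 imset_f ?orbT.
split=> [|y]; last first.
  rewrite !in_setU1 => /orP[/eqP->|/imsetP[d dC ->]]; first by rewrite ux eqxx.
  by rewrite ext_permE imset_f ?orbT ?uC.
apply: stableM; last by apply: stable_tperm => //; rewrite in_setU1 eqxx.
move=> y; rewrite !in_setU1 => /orP[/eqP->|/imsetP[d dC ->]]; first by rewrite v'x eqxx.
by rewrite ext_permE imset_f ?orbT ?vC.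
Qed.

Let connected_fwd : connected_on A x v u -> map_connected M.
Proof.
move=> conn; have sub C : stable v0 C -> stable u0 C -> r0 \in C -> C = [set: dart e].
  move=> vC uC rC; have [vB uB] := stable_ext vC uC rC.
  have /subsetP AB := conn _ (setU11 _ _) vB uB.
  apply/setP => d; rewrite inE; have := AB _ (subsetP (subD1set _ _) _ (iAx d)).
  by rewrite in_setU1 (negbTE (iNx d)) mem_imset.
apply/forallP => c; apply/forallP => d.
have vC := @component_stablev _ v0 u0 c; have uC := @component_stableu _ v0 u0 c.
suff : d \in component v0 u0 c by rewrite inE.
(* A component or its complement contains the root, and a stable set containing the root is
   everything. *)
case: (boolP (r0 \in component v0 u0 c)) => rC; first by rewrite (sub _ vC uC rC) in_setT.
have rC' : r0 \in ~: component v0 u0 c by rewrite in_setC.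
have : c \in ~: component v0 u0 c by rewrite (sub _ (stableC vC) (stableC uC) rC') inE.
by rewrite in_setC component_id.
Qed.

Let connected_bwd : map_connected M -> connected_on A x v u.
Proof.
move=> /forallP conn B xB vB uB.
have RB : R \in B by rewrite -vx vB.
have v'B : stable v' B by rewrite v'E; apply: stableM => //; exact: stable_tperm.
have sub : component v0 u0 r0 \subset i @^-1: B.
  apply: component_sub => [|d|d]; rewrite !inE // -?(ext_permE i_inj);
    [exact: v'B|exact: uB].
apply/subsetP => y yA; have [->//|yx] := eqVneq y x.
have : y \in i @: [set: dart e] by rewrite iA !inE yx.
case/imsetP => d _ ->; have := subsetP sub d; rewrite !inE; apply.
exact: (forallP (conn r0)).
Qed.

Let root_faceE : #|porbit (u * v)%g x| = #|root_face M|.+1.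
Proof.
rewrite porbit_f in_setU1 eqxx /= cardsU1 card_imset //.
by rewrite (_ : x \notin _) //; apply/imsetP => -[d _ E]; have := iNx d; rewrite -E eqxx.
Qed.

Let other_faceE d : d \notin root_face M -> porbit (u * v)%g (i d) = i @: porbit (fperm M) d.
Proof.
move=> dr; rewrite porbit_f in_setU1 (negbTE (iNx d)) mem_imset // (negbTE dr).
by rewrite f'E porbit_ext.
Qed.

Let in_root_face d : (i d \in porbit (u * v)%g x) = (d \in root_face M).
Proof. by rewrite porbit_f setU11 in_setU1 (negbTE (iNx d)) mem_imset. Qed.

Let card_faces_rooted : #|root_face M| = p.*2 ->
  (forall d, d \notin root_face M -> #|porbit (fperm M) d| = 4) ->
  4 * #|faces M| + p.*2 = 4 + e.*2.
Proof.
move=> rf face; have fT : stable (fperm M) [set: dart e] by move=> d; rewrite !in_setT.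
have := card_faces fT (@stable_porbit _ (fperm M) r0) (subsetT _) (fun d _ => face d).
by rewrite -porbits_setT card_imset_porbit cardsT card_ord rf.
Qed.

(** Under [e + p + 2 = 2n] the equation [planar_leg] says precisely that there are [n] vertices. *)
Lemma leg_of_rootedP : reflect (quadrangulation n p M) (legof M \in leg_maps A x p).
Proof.
apply: (iffP (leg_mapsP _ _ _ _)) => /=; rewrite -/v0 -/u0 -/r0 -/v' -/u -/R -/v.
  move=> [L P].
  have rf : #|root_face M| = p.*2 by have := leg_root L; rewrite root_faceE => -[].
  have face d : d \notin root_face M -> #|porbit (fperm M) d| = 4.
    move=> dr; have := @leg_face _ _ _ _ _ _ L (i d).
    rewrite in_root_face dr other_faceE // card_imset // => -> //.
    exact: (subsetP (subD1set _ _) _ (iAx d)).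
  have cV : #|vertices M| = n.
    by move: P; rewrite /planar_leg r_vertices cA; move: np; clear; cardlia.
  apply/and4P; split; first (apply/and3P; split).
  - apply/forallP => d; apply/andP; split.
      by rewrite -(inj_eq i_inj) -(ext_permE i_inj) (leg_fix L) iAx.
    by rewrite -(inj_eq i_inj) -!(ext_permE i_inj) (leg_inv L).
  - exact: connected_fwd (leg_conn L).
  - apply/eqP; have := card_faces_rooted rf face; rewrite cV; move: np; clear; cardlia.
  - by rewrite cV.
  - by rewrite rf.
  - apply/forall_inP => _ /imsetP[d _ ->]; apply/implyP => dF; apply/eqP/face.
    by apply: contra dF; rewrite -eq_porbit_mem.
case/and4P => /and3P[/forallP inv conn _] /eqP cV /eqP rf /forall_inP face.
split; last by rewrite /planar_leg r_vertices cV cA; move: np; clear; lia.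
split=> //.
- rewrite vE; apply: perm_onM; first exact: perm_on_tperm2.
  by case: (perm_onU1 v'on).
- move=> y; case: (boolP (y \in A :\ x)) => yA; last by rewrite !(out_perm uon yA).
  move: yA; rewrite -iA => /imsetP[d _ ->]; rewrite !ext_permE.
  by have /andP[_ /eqP->] := inv d.
- move=> y; case: (boolP (y \in A :\ x)) => yA; last by rewrite (out_perm uon yA) eqxx.
  move: yA; rewrite -iA => /imsetP[d _ ->]; rewrite !ext_permE (inj_eq i_inj).
  by have /andP[/negbTE-> _] := inv d.
- exact: connected_bwd.
- by rewrite root_faceE rf.
- move=> y yA yf; have yx : y != x by apply: contraNneq yf => ->; exact: porbit_id.
  have : y \in i @: [set: dart e] by rewrite iA !inE yx.
  case/imsetP => d _ yE; move: yf; rewrite yE in_root_face => dr.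
  rewrite other_faceE // card_imset //; apply/eqP.
  apply: (implyP (face _ _)); first exact: imset_f.
  by apply: contra dr; rewrite eq_porbit_mem.
Qed.
End OneMap.
End LegOfRooted.

(** * Labelled maps and isomorphism classes *)

Section CountRooted.
Variables (e n p : nat) (T : finType) (A : {set T}) (x : T).
Hypotheses (xA : x \in A) (cA : #|A| = e.*2.+1) (np : e + p + 2 = n.*2) (p0 : 0 < p).

Lemma card_setD1 : #|A :\ x| = e.*2.
Proof. by move: (cardsD1 x A); rewrite xA cA => -[]. Qed.

Definition leg_labelling (d : dart e) : T := enum_val (cast_ord (esym card_setD1) d).

Lemma leg_labelling_inj : injective leg_labelling.
Proof. by move=> c d /enum_val_inj/cast_ord_inj. Qed.

Lemma leg_labelling_im : leg_labelling @: [set: dart e] = A :\ x.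
Proof.
apply/eqP; rewrite eqEcard card_imset; last exact: leg_labelling_inj.
rewrite cardsT card_ord card_setD1 leqnn andbT.
by apply/subsetP => _ /imsetP[d _ ->]; exact: enum_valP.
Qed.

Local Notation iP := leg_labelling_inj.
Local Notation legof := (leg_of_rooted iP x).

Lemma leg_of_rooted_inj (i : dart e -> T) (i_inj : injective i) :
  i @: [set: dart e] = A :\ x -> injective (leg_of_rooted i_inj x).
Proof.
move=> iA [[v1 u1] r1] [[v2 u2] r2] [].
rewrite /vperm /eperm /Defs.root /= => Ev /ext_perm_inj ->.
have fix_x s : ext_perm i_inj s x = x.
  by rewrite (out_perm (ext_perm_on _ _)) // iA !inE eqxx.
have r12 : r1 = r2.
  by apply: (i_inj); move/permP/(_ x): Ev; rewrite !permM !fix_x !tpermL.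
by move: Ev; rewrite r12 => /mulIg/ext_perm_inj->.
Qed.

(** For [p > 0] the leg is not alone at its vertex, so the root dart is recovered as [v x]. *)
Lemma card_leg_maps_rooted : #|leg_maps A x p| = #|[set M : rmap e | quadrangulation n p M]|.
Proof.
have iA := leg_labelling_im.
rewrite -(card_imset _ (leg_of_rooted_inj (i_inj := iP) iA)); apply: eq_card => m.
apply/idP/imsetP => [mL|[M]]; last by rewrite inE => /(leg_of_rootedP iP xA iA np) ML ->.
have /leg_mapsP[M P] := mL.
have vNx : m.1 x != x.
  apply/eqP => E; have := leg_root M; rewrite porbit_fix ?cards1; first by case: p p0.
  by rewrite permM (leg_ux M).
have vxA : m.1 x \in A :\ x by rewrite !inE vNx (perm_closed _ (leg_on M)) xA.
have /imsetP[r _ rE] : m.1 x \in leg_labelling @: [set: dart e] by rewrite iA.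
have [|v0 v0E] := @ext_perm_onto _ _ leg_labelling iP (m.1 * tperm x (m.1 x))%g.
  rewrite iA; apply: perm_onD1; last by rewrite permM tpermR.
  apply: perm_onM (leg_on M) _; apply: perm_on_tperm2 => //.
  by rewrite (perm_closed _ (leg_on M)).
have [|u0 u0E] := @ext_perm_onto _ _ leg_labelling iP m.2.
  by rewrite iA; apply: perm_onD1 (leg_onu M) (leg_ux M).
have E : m = legof (v0, u0, r).
  rewrite /leg_of_rooted /vperm /eperm /Defs.root /= u0E v0E -rE -mulgA tperm2 mulg1.
  by case: (m).
exists (v0, u0, r) => //; rewrite inE; apply/(leg_of_rootedP iP xA iA np).
by rewrite -E.
Qed.

Definition relabel (f : {perm dart e}) (M : rmap e) : rmap e :=
  ((vperm M ^ f)%g, (eperm M ^ f)%g, f (Defs.root M)).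

Lemma conjgpE (s f : {perm dart e}) d : (s ^ f)%g (f d) = f (s d).
Proof. by rewrite /conjg !permM permK. Qed.

Lemma map_isoP (M N : rmap e) : reflect (exists f, N = relabel f M) (map_iso M N).
Proof.
apply: (iffP existsP) => [[f /and3P[/forallP fv /forallP fu /eqP fr]]|[f ->]]; exists f.
  case: N fv fu fr => [[v u] r]; rewrite /relabel /vperm /eperm /Defs.root /= => fv fu ->.
  congr (_, _, _); apply/permP => d; rewrite -[d](permKV f) /conjg !permM permK;
    [have := fv (f^-1 d)%g|have := fu (f^-1 d)%g]; by rewrite permKV => /eqP->.
rewrite /relabel /Defs.root /= eqxx andbT.
apply/andP; split; apply/forallP => d; apply/eqP/esym;
  [exact: (conjgpE (vperm M))|exact: (conjgpE (eperm M))].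
Qed.

(** Relabelling [M] by [f] and changing the labelling to its composite with [f] give the same legged
    map. *)
Lemma relabel_quadrangulation f M : quadrangulation n p M -> quadrangulation n p (relabel f M).
Proof.
have iA := leg_labelling_im; have if_inj := inj_comp iP (@perm_inj _ f).
have ifA : (leg_labelling \o f) @: [set: dart e] = A :\ x.
  rewrite imset_comp (_ : f @: _ = [set: dart e]) //.
  by apply/setP => d; rewrite inE -[d](permKV f) imset_f ?inE.
move/(leg_of_rootedP if_inj xA ifA np) => H; apply/(leg_of_rootedP iP xA iA np).
suff -> : legof (relabel f M) = leg_of_rooted if_inj x M by [].
have extf s : ext_perm iP (s ^ f)%g = ext_perm if_inj s.
  apply/permP => y; case: (boolP (y \in A :\ x)) => yA; last first.
    by rewrite (out_perm (ext_perm_on _ _)) ?iA // (out_perm (ext_perm_on _ _)) ?ifA.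
  move: yA; rewrite -ifA => /imsetP[d _ ->].
  by rewrite ext_permE /= ext_permE /conjg !permM permK.
by rewrite /leg_of_rooted {1}/vperm {1}/eperm /= !extf.
Qed.

(** Rigidity of rooted maps: two relabellings with the same result agree at the root, and their
    agreement propagates along [vperm] and [eperm]. *)
Lemma relabel_inj M : map_connected M -> injective (relabel^~ M).
Proof.
move=> /forallP conn f g [ev eu er]; rewrite -!/(vperm M) -!/(eperm M) in ev eu; apply/permP => d.
have sub : component (vperm M) (eperm M) (Defs.root M) \subset [set d | f d == g d].
  apply: component_sub => [|c|c]; rewrite !inE ?er // => /eqP E.
    by rewrite -(conjgpE (vperm M) f) -(conjgpE (vperm M) g) -ev E.
  by rewrite -(conjgpE (eperm M) f) -(conjgpE (eperm M) g) -eu E.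
by have := subsetP sub d; rewrite !inE (forallP (conn _)) => /(_ isT)/eqP.
Qed.

Lemma card_quadrangulations :
  #|[set M : rmap e | quadrangulation n p M]| = nquad_edges e n p * (e.*2)`!.
Proof.
set D := [set M : rmap e | _]; have eqv : {in D & &, equivalence_rel (@map_iso e)}.
  by move=> M N P _ _ _; exact: map_iso_equiv.
have part : partition (equivalence_partition (@map_iso e) D) D.
  exact: equivalence_partitionP.
rewrite (card_uniform_partition (n := (e.*2)`!) _ part) // => _ /imsetP[M MD ->].
have QM : quadrangulation n p M by move: MD; rewrite inE.
have conn : map_connected M by case/and4P: QM => /and3P[].
have -> : [set N in D | map_iso M N] = relabel^~ M @: [set: {perm dart e}].
  apply/setP => N; rewrite inE; apply/andP/imsetP => [[_ /map_isoP[f ->]]|[f _ ->]].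
    by exists f; rewrite ?inE.
  by split; [rewrite inE; exact: relabel_quadrangulation|apply/map_isoP; exists f].
rewrite card_imset; last exact: relabel_inj.
by rewrite cardsT card_Sn.
Qed.
End CountRooted.

(* Euler's formula forces (e + p + 2)/2 vertices; e = p = 0 is the            *)
(* single-vertex map, which is not an rmap but is a legged map.               *)
Definition map_count (e p : nat) : nat :=
  if p is 0 then e == 0 else if odd (e + p) then 0 else nquad_edges e ((e + p + 2)./2) p.

(** Each class of rooted maps has [(2e)!] labellings; when [e + p] is odd, the planarity equation
    fails modulo 4. *)
Lemma card_leg_maps (T : finType) (A : {set T}) (x : T) (e p : nat) :
  x \in A -> #|A| = e.*2.+1 -> #|leg_maps A x p| = map_count e p * (e.*2)`!.
Proof.
move=> xA cA; case: p => [|p].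
  rewrite leg_maps0 /map_count; case: eqP => [AE|nA].
    by move: cA; rewrite AE cards1; case: e.
  case: e cA => // cA; case: nA; have /cards1P[y E] : #|A| == 1 by rewrite cA.
  by move: xA; rewrite E => /set1P->.
rewrite /map_count; case: ifP => odd_ep.
  apply/eqP; rewrite cards_eq0; apply/eqP/setP => m; rewrite in_set0.
  apply/leg_mapsP => -[_]; rewrite /planar_leg cA => E.
  suff : ~~ odd (e + p.+1) by rewrite odd_ep.
  by move: E; clear; cardlia.
have np : e + p.+1 + 2 = ((e + p.+1 + 2)./2).*2.
  by rewrite -[LHS]odd_double_half oddD odd_ep.
by rewrite (card_leg_maps_rooted xA cA np) // (card_quadrangulations xA cA np).
Qed.

Lemma card_leg_maps_even (T : finType) (A : {set T}) (x : T) (p : nat) :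
  ~~ odd #|A| -> #|leg_maps A x p| = 0.
Proof.
move=> ev; apply/eqP; rewrite cards_eq0; apply/eqP/setP => m; rewrite in_set0.
by apply/leg_mapsP => -[M _]; move: ev; rewrite (leg_oddA M).
Qed.

(** * Recursion for the numbers of quadrangulations *)

Lemma sum_subsets (T : finType) (C : {set T}) (G : nat -> nat) :
  \sum_(B : {set T} | B \subset C) G #|B| = \sum_(j < #|C|.+1) 'C(#|C|, j) * G j.
Proof.
rewrite (partition_big (fun B : {set T} => inord #|B| : 'I_(#|C|.+1)) predT) //=.
apply: eq_bigr => j _; rewrite -cards_draws -sum_nat_const.
apply: eq_big => [B|B /andP[BC /eqP<-]]; rewrite ?inE.
  case: (boolP (B \subset C)) => //= BC.
  by rewrite -val_eqE /= inordK // ltnS subset_leq_card.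
by rewrite inordK // ltnS subset_leq_card.
Qed.

Lemma sum_even_terms (f : nat -> nat) n : (forall j, odd j -> f j = 0) ->
  \sum_(j < n.*2.+1) f j = \sum_(k < n.+1) f k.*2.
Proof.
move=> f0; elim: n => [|n IH]; first by rewrite !big_ord1.
by rewrite doubleS 2!big_ord_recr /= IH f0 ?addn0 ?[RHS]big_ord_recr //= odd_double.
Qed.

(** Apply [card_leg_maps_rec] to a set of [2e + 3] darts. There are [(2e+2)(2e+1)] choices of [r]
    and [s], and [(2k)! (2e-2k)!] times the binomial coefficient is [(2e)!]; the common factor
    [(2e+2)!] is cancelled. *)
Lemma map_count_rec e p : map_count e.+1 p.+1 = map_count e p.+2 +
  \sum_(k < e.+1) \sum_(a < p.+1) map_count k a * map_count (e - k) (p - a).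
Proof.
set X := RHS; pose T := 'I_(e.+1).*2.+1; pose A := [set: T]; pose x : T := ord0.
have xA : x \in A by rewrite inE.
have cA : #|A| = (e.+1).*2.+1 by rewrite cardsT card_ord.
have := card_leg_maps_rec p xA; rewrite (card_leg_maps _ xA cA).
have fibre r s : r \in A :\ x -> s \in A :\ x :\ r ->
  #|leg_maps (A :\ r :\ s) x p.+2| +
     \sum_(A1 : {set T} | (x \in A1) && (A1 \subset A :\ r :\ s))
       \sum_(a < p.+1) #|leg_maps A1 x a| * #|leg_maps (A :\ r :\: A1) s (p - a)|
  = (e.*2)`! * X.
  rewrite !in_setD1 !in_setT !andbT => rNx /andP[sNr sNx].
  have cAr : #|A :\ r| = (e.+1).*2 by move: (cardsD1 r A); rewrite cA in_setT => -[].
  have sAr : s \in A :\ r by rewrite !inE sNr.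
  have cArs : #|A :\ r :\ s| = e.*2.+1.
    by move: (cardsD1 s (A :\ r)); rewrite cAr sAr => -[].
  have xArs : x \in A :\ r :\ s by rewrite !inE [x == s]eq_sym sNx eq_sym rNx.
  pose C := A :\ r :\ s :\ x.
  have cC : #|C| = e.*2 by move: (cardsD1 x (A :\ r :\ s)); rewrite cArs xArs => -[].
  rewrite (card_leg_maps p.+2 xArs cArs) mulnC /X mulnDr; congr (_ + _).
  rewrite (reindex_onto (fun B : {set T} => x |: B) (fun A1 => A1 :\ x)) /=; last first.
    by move=> A1 /andP[xA1 _]; exact: setD1K.
  (* The summand depends only on [#|B|]. It vanishes for odd [#|B|], as a legged map has an odd
     number of darts, counting its leg. *)
  pose G j := if odd j then 0 else
    (j`! * (e.*2 - j)`!) * \sum_(a < p.+1) map_count j./2 a * map_count (e - j./2) (p - a).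
  rewrite (eq_bigl (fun B : {set T} => B \subset C)); last first.
    move=> B; rewrite setU11 subUset sub1set xArs /= [in RHS]subsetD1.
    congr (_ && _); rewrite setDUl setDv set0U; apply/eqP/idP => [<-|xB].
      by rewrite !inE eqxx.
    by apply/setDidPl; rewrite disjoint_sym disjoints1.
  rewrite (eq_bigr (fun B : {set T} => G #|B|)); last first.
    move=> B BC; have xB : x \notin B.
      by apply: contraTN BC => xB; apply/negP => /subsetP/(_ _ xB); rewrite !inE eqxx.
    have cxB : #|x |: B| = #|B|.+1 by rewrite cardsU1 xB.
    have le : #|B| <= e.*2 by rewrite -cC subset_leq_card.
    rewrite /G; case: ifP => oB.
      by rewrite big1 // => a _; rewrite card_leg_maps_even ?mul0n // cxB /= oB.
    have cB : #|B| = (#|B|./2).*2 by rewrite -[LHS]odd_double_half oB.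
    have sub : x |: B \subset A :\ r.
      apply/subsetP => y; rewrite in_setU1 => /orP[/eqP->|/(subsetP BC)].
        by rewrite !inE eq_sym rNx.
      by rewrite !inE => /and4P[_ _ ->].
    have cD : #|A :\ r :\: (x |: B)| = (e - #|B|./2).*2.+1.
      rewrite cardsD (setIidPr sub) cAr cxB [in LHS]cB; move: le; rewrite [in X in X -> _]cB.
      by clear; lia.
    have sD : s \in A :\ r :\: (x |: B).
      rewrite in_setD sAr andbT in_setU1 negb_or sNx /=.
      by apply/negP => /(subsetP BC); rewrite !inE eqxx andbF.
    rewrite big_distrr /=; apply: eq_bigr => a _.
    rewrite (card_leg_maps a (setU11 x B) (e := #|B|./2)); last by rewrite cxB [in LHS]cB.
    rewrite (card_leg_maps (p - a) sD cD).
    rewrite doubleB -cB; move: (_`!) (_`!) => i j; ring.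
  rewrite sum_subsets cC (@sum_even_terms (fun j => 'C(e.*2, j) * G j)); last first.
    by move=> j oj; rewrite /G oj muln0.
  rewrite big_distrr /=; apply: eq_bigr => k _; rewrite /G odd_double doubleK mulnA.
  by rewrite bin_fact // leq_double -ltnS.
rewrite (eq_bigr (fun=> (e.*2.+1) * ((e.*2)`! * X))); last first.
  move=> r rA; rewrite (eq_bigr (fun=> (e.*2)`! * X)); last by move=> s; exact: fibre.
  rewrite sum_nat_const; congr (_ * _).
  move: (cardsD1 x A) (cardsD1 r (A :\ x)); rewrite cA xA rA; clear; cardlia.
rewrite sum_nat_const; have -> : #|A :\ x| = e.*2.+2 by move: (cardsD1 x A); rewrite cA xA => -[].
move=> E; apply/eqP; rewrite -(eqn_pmul2r (fact_gt0 (e.+1).*2)) E doubleS !factS.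
by apply/eqP; ring.
Qed.

(** The [2p + 1] darts of the root face must fit among [2e + 1]. *)
Lemma map_count_lt e p : e < p -> map_count e p = 0.
Proof.
move=> ep; have x0 : (ord0 : 'I_e.*2.+1) \in [set: 'I_e.*2.+1] by rewrite inE.
have c0 : #|[set: 'I_e.*2.+1]| = e.*2.+1 by rewrite cardsT card_ord.
have := card_leg_maps p x0 c0; rewrite (_ : #|_| = 0).
  by move/esym/eqP; rewrite muln_eq0 (gtn_eqF (fact_gt0 _)) orbF => /eqP.
apply/eqP; rewrite cards_eq0; apply/eqP/setP => m; rewrite in_set0.
apply/leg_mapsP => -[M _]; have := subset_leq_card (leg_rootS M).
by rewrite c0 (leg_root M) ltnS leq_double leqNgt ep.
Qed.

(** Only [e = 2n - p - 2] contributes to the sum over edge numbers; the guard keeps the truncated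
    subtraction honest. *)
Lemma nquadE n p : nquad n p =
  if p + 2 <= n.*2 then map_count (n.*2 - p - 2) p else 0.
Proof.
case: p => [|p]; first by rewrite /nquad /map_count; case: n => [|[|n]].
have none e : e + p.+1 + 2 != n.*2 -> nquad_edges e n p.+1 = 0.
  move=> ne; apply/eqP; rewrite cards_eq0 /equivalence_partition.
  rewrite (_ : [set M | _] = set0) ?imset0 //; apply/setP => M; rewrite !inE.
  by apply: contraNF ne => /quadrangulation_edges/eqP.
rewrite /nquad; case: ifP => le; last by rewrite big1 // => e _; apply: none; lia.
pose e0 := n.*2 - p.+1 - 2; have lt : e0 < n.*2 by rewrite /e0; lia.
rewrite (bigD1 (Ordinal lt)) //= big1 ?addn0; last first.
  move=> e; rewrite -val_eqE /= /e0 => ne; apply: none; apply: contraNneq ne => E.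
  by apply/eqP; lia.
have eE : e0 + p.+1 + 2 = n.*2 by rewrite /e0; lia.
by rewrite /map_count -/e0 eE doubleK ifF //; lia.
Qed.

Lemma map_count_odd e p : odd (e + p) -> map_count e p = 0.
Proof. by rewrite /map_count; case: p => [|p ->//]; case: e. Qed.

Lemma map_count_convolution e n p a : a <= p -> n.*2 = e + p + 4 ->
  \sum_(k < e.+1) map_count k a * map_count (e - k) (p - a) =
  \sum_(i < n.+1) nquad i a * nquad (n - i) (p - a).
Proof.
move=> ap nE.
(* Both sums are read over [j = k + a + 2], twice the number of vertices of the first factor; odd
   [j] contribute nothing. *)
pose f j := if (a + 2 <= j) && (j <= a + 2 + e)
  then map_count (j - a - 2) a * map_count (e - (j - a - 2)) (p - a) else 0.
transitivity (\sum_(j < n.*2.+1) f j); last first.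
  rewrite sum_even_terms => [|j oj].
    apply: eq_bigr => i _; rewrite !nquadE /f.
    case: (leqP (a + 2) i.*2) => //= ai.
    have -> : (i.*2 <= a + 2 + e) = (p - a + 2 <= (n - i).*2) by have := ltn_ord i; lia.
    case: ifP => ib; rewrite ?muln0 //; congr (_ * map_count _ _).
    by have := ltn_ord i; lia.
  rewrite /f; case: ifP => // /andP[aj _]; rewrite map_count_odd ?mul0n //.
  by move: oj aj; clear; lia.
rewrite -(big_mkord predT (fun k => map_count k a * map_count (e - k) (p - a))).
rewrite -(big_mkord predT f) [RHS](big_cat_nat (n := a + 2)) //=; last by lia.
rewrite (big_cat_nat (m := a + 2) (n := a + 2 + e.+1)) //=; [|by lia|by lia].
rewrite [X in X + _]big_nat_cond [X in X + _]big1; last first.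
  by move=> j /andP[/andP[_ ja] _]; rewrite /f leqNgt ja.
rewrite [X in _ + (_ + X)]big_nat_cond [X in _ + (_ + X)]big1; last first.
  by move=> j /andP[/andP[ja _] _]; rewrite /f; case: ifP => //; lia.
rewrite add0n addn0 -{1}[a + 2]add0n big_addn.
have -> : a + 2 + e.+1 - (a + 2) = e.+1 by lia.
rewrite big_nat_cond [RHS]big_nat_cond; apply: eq_bigr => k /andP[/andP[_ ke] _].
rewrite /f ifT; last by lia.
by have -> : k + (a + 2) - a - 2 = k by lia.
Qed.

(* Tutte's recursion: deleting the root edge either disconnects the map or    *)
(* merges the root face with a quadrangle.                                    *)
Lemma nquad_rec n p : nquad n p.+1 = nquad n p.+2 +
  \sum_(a < p.+1) \sum_(i < n.+1) nquad i a * nquad (n - i) (p - a).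
Proof.
(* When [2n <= p + 3] there are too few vertices and every term is zero; otherwise the map has at
   least one edge to delete. *)
have [lt|ge] := ltnP (p + 3) n.*2; last first.
  rewrite big1 => [|a _]; last first.
    rewrite big1 // => i _; rewrite !nquadE.
    case: ifP => // ai; case: ifP; rewrite ?muln0 // => ib; exfalso.
    by have := ltn_ord a; have := ltn_ord i; lia.
  rewrite addn0 !nquadE; case: ifP => [le|_]; last by case: ifP => // ?; lia.
  have -> : n.*2 - p.+1 - 2 = 0 by lia.
  by rewrite map_count_lt //; case: ifP => // ?; lia.
pose e := n.*2 - p - 4; have nE : n.*2 = e + p + 4 by rewrite /e; lia.
rewrite 2!nquadE !ifT; [|by lia|by lia].
have -> : n.*2 - p.+1 - 2 = e.+1 by lia.
have -> : n.*2 - p.+2 - 2 = e by lia.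
rewrite map_count_rec exchange_big /=; congr (_ + _); apply: eq_bigr => a _.
by apply: map_count_convolution => //; rewrite -ltnS.
Qed.

Lemma nquad_large n p : 0 < p -> n <= p -> nquad n p = 0.
Proof.
move=> p0 np; rewrite nquadE; case: ifP => // le.
by apply: map_count_lt; lia.
Qed.

(** * Power series *)

Local Open Scope ring_scope.

(** * Catalan numbers from their ratio recurrence *)

Section Catalan.
Import Num.Theory.
Variable F : numFieldType.

Fixpoint catalan n : F :=
  if n is m.+1 then (4 * m + 2)%:R / (m + 2)%:R * catalan m else 1.

Lemma catalanS n : (n + 2)%:R * catalan n.+1 = (4 * n + 2)%:R * catalan n.
Proof.
by rewrite /= mulrA mulrCA mulfV ?mulr1 // pnatr_eq0 addn2.
Qed.

Lemma catalan0 : catalan 0 = 1. Proof. by []. Qed.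
Lemma catalan1 : catalan 1 = 1.
Proof. by rewrite /= mulr1 divff // pnatr_eq0. Qed.

Arguments catalan : simpl never.

Let S n := \sum_(i < n.+1) catalan i * catalan (n - i).

(** Symmetry of the convolution under exchanging [i] and [n - i]. *)
Let weighted n : 2 * \sum_(i < n.+1) i%:R * (catalan i * catalan (n - i)) = n%:R * S n.
Proof.
set g := fun i : 'I_n.+1 => i%:R * (catalan i * catalan (n - i)).
have e : \sum_i g i = \sum_(i < n.+1) (n - i)%:R * (catalan i * catalan (n - i)).
  rewrite (reindex_inj rev_ord_inj) /=; apply: eq_bigr => i _.
  by rewrite /g /= subSS (subKn (leq_ord i)) [catalan i * _]mulrC.
rewrite -[2]/(1 + 1) mulrDl mul1r {2}e -big_split /= /S mulr_sumr; apply: eq_bigr => i _.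
by rewrite /g -mulrDl -natrD subnKC // leq_ord.
Qed.

(** By [weighted] and [catalanS] the convolutions satisfy [(n+3) S (n+1) = 2 C_(n+1) + (4n+4) S n];
    with the induction hypothesis this is the ratio recurrence. *)
Lemma catalan_convolution n : \sum_(i < n.+1) catalan i * catalan (n - i) = catalan n.+1.
Proof.
rewrite -/(S n); elim: n => [|n IH].
  by rewrite /S big_ord1 subn0 catalan0 catalan1 mulr1.
have h : (n + 3)%:R * S n.+1 = 2 * catalan n.+1 + (4 * n + 4)%:R * S n.
  have -> : (n + 3)%:R * S n.+1 =
      2 * \sum_(i < n.+2) (i + 1)%:R * (catalan i * catalan (n.+1 - i)).
    under eq_bigr => i _ do rewrite natrD mulrDl mul1r.
    by rewrite big_split /= mulrDr weighted -/(S n.+1) -mulrDl -natrD; congr (_%:R * _); lia.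
  rewrite big_ord_recl /= add0n subn0 catalan0 !mul1r mulrDr; congr (_ + _).
  under eq_bigr => i _ do rewrite /bump /= add1n subSS addn1 -addn2 mulrA catalanS -mulrA natrD mulrDl natrM -mulrA.
  rewrite big_split /= mulrDr -!mulr_sumr -/(S n) mulrCA weighted !mulrA -mulrDl.
  by congr (_ * S n); ring.
apply: (@mulfI _ (n + 3)%:R); first by rewrite pnatr_eq0; lia.
rewrite h IH (_ : (n + 3)%N = (n.+1 + 2)%N) ?catalanS; last by lia.
by rewrite -mulrDl; congr (_ * _); rewrite -natrD; congr (_%:R); lia.
Qed.
End Catalan.
Arguments catalan : simpl never.

(** * Coefficients and derivatives of power series *)

Section FpsExtra.
Variable R : comNzRingType.
Implicit Types f g : {fps R}.

Lemma fcoef_sum (I : Type) (r : seq I) (P : pred I) (G : I -> {fps R}) n :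
  fcoef (\sum_(i <- r | P i) G i) n = \sum_(i <- r | P i) fcoef (G i) n.
Proof. by elim/big_rec2: _ => // i a b _ <-; rewrite fcoefD. Qed.

Lemma fcoef_constM c f n : fcoef (fps_const c * f) n = c * fcoef f n.
Proof.
by rewrite fcoefM big_ord_recl /= subn0 big1 ?addr0 // => i _; rewrite mul0r.
Qed.

Lemma fps_constM c d : fps_const (c * d) = fps_const c * fps_const d :> {fps R}.
Proof. by apply/fpsP => n; rewrite fcoef_constM /=; case: eqP; rewrite ?mulr0. Qed.

Lemma fps_constD c d : fps_const (c + d) = fps_const c + fps_const d :> {fps R}.
Proof. by apply/fpsP => n; rewrite fcoefD /=; case: eqP; rewrite ?addr0. Qed.

Lemma fps_const_nat n : fps_const n%:R = n%:R :> {fps R}.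
Proof.
elim: n => [|n IH]; first by apply/fpsP => n; rewrite /=; case: eqP.
by rewrite !mulrS fps_constD IH.
Qed.

Lemma fps_const_sum (I : Type) (r : seq I) (P : pred I) (G : I -> R) :
  fps_const (\sum_(i <- r | P i) G i) = \sum_(i <- r | P i) fps_const (G i) :> {fps R}.
Proof.
elim/big_rec2: _ => [|i a b _ <-]; last by rewrite fps_constD.
by apply/fpsP => n; rewrite /=; case: eqP.
Qed.

Lemma fps_derivD f g : fps_deriv (f + g) = fps_deriv f + fps_deriv g.
Proof. by apply/fpsP => n; rewrite /= mulrnDl. Qed.

Lemma fps_derivN f : fps_deriv (- f) = - fps_deriv f.
Proof. by apply/fpsP => n; rewrite /= mulNrn. Qed.

Lemma fps_deriv_constM c f : fps_deriv (fps_const c * f) = fps_const c * fps_deriv f.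
Proof.
apply/fpsP => n; rewrite fcoef_constM.
by rewrite -[LHS]/(fcoef (fps_const c * f) n.+1 *+ n.+1) fcoef_constM mulrnAr.
Qed.

Lemma fps_derivM f g : fps_deriv (f * g) = fps_deriv f * g + f * fps_deriv g.
Proof.
apply/fpsP => n; rewrite fcoefD !fcoefM -[LHS]/(fcoef (f * g) n.+1 *+ n.+1) fcoefM.
rewrite -sumrMnl (eq_bigr (fun i : 'I_n.+2 => fcoef f i *+ i * fcoef g (n.+1 - i) +
    fcoef f i * (fcoef g (n.+1 - i) *+ (n.+1 - i)))); last first.
  by move=> i _; rewrite mulrnAl mulrnAr -mulrnDr subnKC // -ltnS.
rewrite big_split /=; congr (_ + _).
  by rewrite big_ord_recl mulr0n mul0r add0r; exact: eq_bigr.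
rewrite big_ord_recr /= subnn mulr0n mulr0 addr0; apply: eq_bigr => i _.
by rewrite subSn // -ltnS.
Qed.

Lemma fps_derivX f n : fps_deriv (f ^+ n.+1) = n.+1%:R * f ^+ n * fps_deriv f.
Proof.
elim: n => [|n IH]; first by rewrite expr1 expr0 !mul1r.
by rewrite exprS fps_derivM IH !exprS [n.+2%:R]mulrS; ring.
Qed.

Lemma fps_deriv_fpsX : fps_deriv (fpsX : {fps R}) = 1.
Proof. by apply/fpsP => -[|n]; rewrite /= ?mul0rn. Qed.

Lemma fcoef_fpsXn_lt f k n : (n < k)%N -> fcoef (fpsX ^+ k * f) n = 0.
Proof.
elim: k n => // k IH [|n] ltnk; rewrite exprS -mulrA fcoefXM //.
exact: IH.
Qed.

End FpsExtra.

(** * The explicit solution of the recursion *)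

Definition catalan_fps (p : nat) : {fps rat} := fps_const (catalan rat p).
Local Notation K := catalan_fps.

Lemma catalan_fps0 : K 0 = 1. Proof. by []. Qed.

Lemma catalan_fpsS p : (p + 2)%:R * K p.+1 = (4 * p + 2)%:R * K p.
Proof. by rewrite /K -!fps_const_nat -!fps_constM catalanS. Qed.

Lemma catalan_fps_convolution p : \sum_(i < p.+1) K i * K (p - i) = K p.+1.
Proof.
rewrite /K -catalan_convolution fps_const_sum; apply: eq_bigr => i _.
by rewrite fps_constM.
Qed.

Lemma catalan_fps1 : K 1 = 1.
Proof. by rewrite -catalan_fps_convolution big_ord1 catalan_fps0 mul1r. Qed.

Lemma catalan_fps2 : K 2 = 2.
Proof.
by rewrite -catalan_fps_convolution 2!big_ord_recl big_ord0 /= catalan_fps0 catalan_fps1; ring.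
Qed.

(** The solution of [R = x + 3 R^2] without constant term, as a rescaled Catalan series. *)
Definition R_series : {fps rat} := fpsX * FPS (fun n => 3 ^+ n * catalan rat n).

Lemma R_seriesE : xQ = R_series - 3 * R_series ^+ 2.
Proof.
rewrite /R_series; set G := FPS _.
suff e : G = 1 + 3 * (fpsX * G ^+ 2) by rewrite {1}e /xQ; ring.
apply/fpsP => -[|n].
  by rewrite fcoefD mulr_natl fcoefMn fcoefXM mul0rn /= mulr1 addr0.
rewrite fcoefD fcoef1 add0r mulr_natl fcoefMn fcoefXM expr2 fcoefM -mulr_natl.
rewrite -[LHS]/(3 ^+ n.+1 * catalan rat n.+1) -catalan_convolution exprS -mulrA.
congr (_ * _); rewrite mulr_sumr; apply: eq_bigr => i _ /=.
rewrite -{1}(subnKC (leq_ord i)) exprD; ring.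
Qed.

Lemma R_series_deriv : fps_deriv R_series * (1 - 6 * R_series) = 1.
Proof.
have := congr1 (@fps_deriv _) R_seriesE.
rewrite fps_deriv_fpsX fps_derivD fps_derivN -fps_const_nat fps_deriv_constM.
by rewrite fps_derivX fps_const_nat => e; rewrite [RHS]e; ring.
Qed.

Definition quad_closed (p : nat) : {fps rat} :=
  K p * R_series ^+ p.+1 - (K p.+1 + 2 * K p) * R_series ^+ p.+2.

Lemma quad_closed0 : quad_closed 0 = xQ.
Proof. by rewrite /quad_closed catalan_fps0 catalan_fps1 R_seriesE; ring. Qed.

Lemma fcoef_quad_closed p n : (n <= p)%N -> fcoef (quad_closed p) n = 0.
Proof.
move=> np; have h k f : (p < k)%N -> fcoef (f * R_series ^+ k) n = 0.
  move=> pk; rewrite /R_series exprMn mulrCA fcoef_fpsXn_lt //.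
  exact: leq_ltn_trans pk.
by rewrite fcoefB !h ?subr0.
Qed.

(** Both sides are combinations of [R^(p+2)], [R^(p+3)] and [R^(p+4)]; the shifted convolutions
    [s1], [s2], [s3] differ from full Catalan ones only by boundary terms. *)
Lemma quad_closed_rec p : quad_closed p.+1 = quad_closed p.+2 + \sum_(a < p.+1) quad_closed a * quad_closed (p - a).
Proof.
pose R := R_series.
have shift (f : nat -> nat -> {fps rat}) : \sum_(a < p.+1) f a.+1 (p - a)%N =
    \sum_(a < p.+2) f a (p.+1 - a)%N - f 0%N p.+1.
  by rewrite [in RHS]big_ord_recl subn0 addrC addKr; apply: eq_bigr.
have s1 : \sum_(a < p.+1) K a.+1 * K (p - a) = K p.+2 - K p.+1.
  by rewrite (shift (fun i j => K i * K j)) catalan_fps_convolution catalan_fps0 mul1r.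
have s2 : \sum_(a < p.+1) K a * K (p - a).+1 = K p.+2 - K p.+1.
  rewrite -s1 (reindex_inj rev_ord_inj) /=; apply: eq_bigr => a _.
  by rewrite subSS (subKn (leq_ord a)) mulrC.
have s3 : \sum_(a < p.+1) K a.+1 * K (p - a).+1 = K p.+3 - 2 * K p.+2.
  rewrite (shift (fun i j => K i * K j.+1)) catalan_fps0 mul1r.
  have -> : \sum_(a < p.+2) K a * K (p.+1 - a).+1 = K p.+3 - K p.+2.
    have := catalan_fps_convolution p.+2.
    rewrite big_ord_recr /= subnn catalan_fps0 mulr1 => <-; rewrite addrK.
    by apply: eq_bigr => a _; rewrite -(subSn (leq_ord a)).
  by ring.
have s0 := catalan_fps_convolution p.
rewrite (eq_bigr (fun a : 'I_p.+1 => R ^+ p.+2 * (K a * K (p - a)) -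
   R ^+ p.+3 * (K a * K (p - a).+1 + K a.+1 * K (p - a) + 4 * (K a * K (p - a))) +
   R ^+ p.+4 * (K a.+1 * K (p - a).+1 + 2 * (K a.+1 * K (p - a)) + 2 * (K a * K (p - a).+1)
     + 4 * (K a * K (p - a))))); last first.
  move=> a _; rewrite /quad_closed -/R.
  have -> : R ^+ p.+2 = R ^+ a.+1 * R ^+ (p - a).+1.
    by rewrite -exprD addSn addnS subnKC // leq_ord.
  have -> : R ^+ p.+3 = R ^+ a.+2 * R ^+ (p - a).+1.
    by rewrite -exprD !addSn addnS subnKC // leq_ord.
  have -> : R ^+ p.+4 = R ^+ a.+2 * R ^+ (p - a).+2.
    by rewrite -exprD !addSn !addnS subnKC // leq_ord.
  have -> : R ^+ a.+2 = R * R ^+ a.+1 by rewrite exprS.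
  have -> : R ^+ (p - a).+2 = R * R ^+ (p - a).+1 by rewrite exprS.
  by ring.
rewrite big_split sumrB /= -!mulr_sumr !big_split /= -!mulr_sumr s0 s1 s2 s3 /quad_closed -/R.
by ring.
Qed.

Definition quad_series (p : nat) : {fps rat} := fcoef Q2 p.

(** The truncation in [Q2] discards only zeros, by [nquad_large]. *)
Lemma fcoef_quad_series p n : fcoef (quad_series p) n = (nquad n p)%:R.
Proof.
rewrite /quad_series /=; case: ifP => // /negbT; rewrite negb_and -leqNgt -ltnNge.
case: n => [|n] /=; first by case: p => //= p _; rewrite big_ord0.
by move=> np; rewrite nquad_large // (leq_trans _ np) // ltnW.
Qed.

Lemma quad_series_rec p : quad_series p.+1 = quad_series p.+2 + \sum_(a < p.+1) quad_series a * quad_series (p - a).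
Proof.
apply/fpsP => n; rewrite fcoefD fcoef_sum !fcoef_quad_series nquad_rec natrD.
congr (_ + _); rewrite natr_sum; apply: eq_bigr => a _; rewrite natr_sum fcoefM; apply: eq_bigr => i _.
by rewrite natrM !fcoef_quad_series.
Qed.

Lemma quad_series0 : quad_series 0 = xQ.
Proof. by apply/fpsP => n; rewrite fcoef_quad_series. Qed.

(** Uniqueness by induction on [n], then on [n - p]: constant terms vanish, so the products involve
    only coefficients below [n], and increasing [p] ends where both sides vanish. *)
Lemma quad_seriesE p : quad_series p = quad_closed p.
Proof.
apply/fpsP => n; elim/ltn_ind: n p => n IHn p.
have [k] := ubnP (n - p); elim: k p => // k IHk [|p] lt; first by rewrite quad_series0 quad_closed0.
have [le|gt] := leqP n p.+1; first by rewrite fcoef_quad_closed // fcoef_quad_series nquad_large.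
rewrite quad_series_rec quad_closed_rec !fcoefD IHk; last by lia.
congr (_ + _); rewrite !fcoef_sum; apply: eq_bigr => a _; rewrite !fcoefM.
have W00 q : fcoef (quad_series q) 0 = 0 by rewrite fcoef_quad_series nquadE; case: ifP => //; lia.
apply: eq_bigr => i _; have [->|i0] := posnP i; first by rewrite W00 (fcoef_quad_closed (leq0n _)) !mul0r.
have [in_|ni] := ltnP i n; last first.
  have -> : (n - i = 0)%N by apply/eqP; rewrite subn_eq0.
  by rewrite W00 (fcoef_quad_closed (leq0n _)) !mulr0.
by rewrite !IHn //; lia.
Qed.

(** By the ratio recurrence [(p+2)(C_(p+1) + 2 C_p) = 6(p+1) C_p], so the factor [R' (1 - 6R) = 1]
    splits off. *)
Lemma quad_closed_deriv p : fps_deriv (quad_closed p) = p.+1%:R * K p * R_series ^+ p.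
Proof.
have e : p.+2%:R * (K p.+1 + 2 * K p) = 6 * (p.+1%:R * K p).
  have := catalan_fpsS p; rewrite addn2 natrD natrM => h.
  by rewrite mulrDr h -[p.+2]addn2 -[p.+1]addn1 !natrD; ring.
have kD c f : fps_deriv (fps_const c * f) = fps_const c * fps_deriv f.
  exact: fps_deriv_constM.
have eB : fps_const (catalan rat p.+1 + 2%:R * catalan rat p) = K p.+1 + 2 * K p.
  by rewrite fps_constD (fps_constM 2%:R) fps_const_nat.
have -> : quad_closed p = fps_const (catalan rat p) * R_series ^+ p.+1 -
    fps_const (catalan rat p.+1 + 2%:R * catalan rat p) * R_series ^+ p.+2 by rewrite eB.
rewrite fps_derivD fps_derivN !kD !fps_derivX eB -/(K p).
transitivity (p.+1%:R * K p * R_series ^+ p * fps_deriv R_series -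
  (p.+2%:R * (K p.+1 + 2 * K p)) * (R_series ^+ p.+1 * fps_deriv R_series)); first by ring.
transitivity (p.+1%:R * K p * R_series ^+ p * (fps_deriv R_series * (1 - 6 * R_series))).
  by rewrite e [R_series ^+ p.+1]exprS; ring.
by rewrite R_series_deriv mulr1.
Qed.

(** With [Q1dot = 2xR] and [Q1 = R^2 - 4R^3], the numerator is [R^2 (1 - 2R)] and the denominator
    [1 - 2R]. *)
Lemma quotient_seriesE : (Q1dot - Q1) / (1 - fps_divX Q1dot) = R_series ^+ 2.
Proof.
have U := denominator_unit.
have dV : Q1dot = xQ * (2 * R_series).
  by rewrite /Q1dot /Q1 -/(quad_series 1) quad_seriesE quad_closed_deriv catalan_fps1 mulr1 expr1.
have dX : fps_divX Q1dot = 2 * R_series.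
  by rewrite dV; apply/fpsP => n; rewrite -[LHS]/(fcoef (fpsX * (2 * R_series)) n.+1) fcoefXM.
apply: (mulIr U); rewrite divrK // dX dV /Q1 -/(quad_series 1) quad_seriesE /quad_closed catalan_fps1 catalan_fps2 R_seriesE.
by ring.
Qed.

Theorem mainTheorem3 :
  Q2dot = x2 + 6 * y2 * Q2dot * fps_const ((Q1dot - Q1) / (1 - fps_divX Q1dot))
             + 2 * x2 * y2 * (3 * Q2dot - 2 * Q2 - y2 * fps_deriv Q2).
Proof.
rewrite quotient_seriesE.
have dot q : fcoef Q2dot q = xQ * fps_deriv (quad_closed q).
  by rewrite fcoef_constM -quad_seriesE.
have -> : 6 * y2 * Q2dot * fps_const (R_series ^+ 2) = y2 * (fps_const (R_series ^+ 2) * (6 * Q2dot)).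
  by ring.
have -> : 2 * x2 * y2 * (3 * Q2dot - 2 * Q2 - y2 * fps_deriv Q2) =
    y2 * (x2 * (2 * (3 * Q2dot - 2 * Q2 - y2 * fps_deriv Q2))) by ring.
apply/fpsP => -[|q]; rewrite !fcoefD dot !fcoefXM.
  by rewrite quad_closed0 fps_deriv_fpsX mulr1 !addr0.
rewrite !fcoef_constM !mulr_natl !fcoefMn !fcoefB !fcoefMn !dot.
have -> : fcoef (y2 * fps_deriv Q2) q = q%:R * quad_series q.
  by rewrite mulr_natl fcoefXM; case: q.
rewrite -/(quad_series q) quad_seriesE !quad_closed_deriv (_ : fcoef x2 q.+1 = 0) // add0r.
have e := catalan_fpsS q; rewrite addn2 natrD natrM in e.
apply/eqP; rewrite -subr_eq0; apply/eqP.
(* After substituting the closed forms and [x = R - 3 R^2], the difference of the two sides is a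
   multiple of the Catalan ratio recurrence. *)
transitivity (xQ * (R_series ^+ q.+1 - 2 * R_series ^+ q.+2) *
  (q.+2%:R * K q.+1 - (4 * q%:R + 2) * K q)); last by rewrite e subrr mulr0.
rewrite /quad_closed R_seriesE ![R_series ^+ q.+2]exprS ![R_series ^+ q.+1]exprS -[q.+2]addn2 -[q.+1]addn1 !natrD.
move: (K q) (K (q + 1)) (R_series ^+ q) R_series (q%:R : {fps rat}) => k k1 Rq R1 qr.
by ring.
Qed.
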